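(* Let $R$ be a ring with identity and let $(\mathsf{M},\mathsf{C})$ be a duality pair over $R$. Then $\mathsf{M}$ is closed under pure submodules, pure quotients, and pure extensions. Furthermore, the following hold: (a) If $(\mathsf{M},\mathsf{C})$ is product-closed then $\mathsf{M}$ is preenveloping. (b) If $(\mathsf{M},\mathsf{C})$ is coproduct-closed then $\mathsf{M}$ is covering. (c) If $(\mathsf{M},\mathsf{C})$ is perfect then $(\mathsf{M},\mathsf{M}^\perp)$ is a perfect cotorsion pair.
   Context: $R$-modules are unitary left $R$-modules; $R^\circ$ is the opposite ring, so $R^\circ$-modules are right $R$-modules. A duality pair over $R$ is a pair $(\mathsf{M},\mathsf{C})$, where $\mathsf{M}$ is a class of $R$-modules and $\mathsf{C}$ is a class of $R^\circ$-modules, such that: (1) for every $R$-module $M$, one has $M\in\mathsf{M}$ if and only if $\mathrm{Hom}_{\mathbb Z}(M,\mathbb Q/\mathbb Z)\in\mathsf{C}$; (2) $\mathsf{C}$ is closed under direct summands and finite direct sums. (As usual, classes of modules are closed under isomorphism.) A duality pair $(\mathsf{M},\mathsf{C})$ is product-closed (resp. coproduct-closed) if $\mathsf{M}$ is closed under products (resp. coproducts) in the category of all $R$-modules. It is perfect if it is coproduct-closed, $\mathsf{M}$ is closed under extensions, and $R\in\mathsf{M}$. Closure under pure submodules, pure quotients, and pure extensions means: for every pure exact sequence $0\to M'\to M\to M''\to0$ of $R$-modules (one that stays exact after tensoring with any right $R$-module), $M\in\mathsf{M}$ if and only if $M',M''\in\mathsf{M}$. An $\mathsf{M}$-precover of a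 module $N$ is a homomorphism $\varphi\colon M\to N$ with $M\in\mathsf{M}$ such that every homomorphism $\varphi'\colon M'\to N$ with $M'\in\mathsf{M}$ factors as $\varphi'=\varphi\psi$ for some (not necessarily unique) $\psi\colon M'\to M$. It is an $\mathsf{M}$-cover if every $\psi\colon M\to M$ with $\varphi=\varphi\psi$ is an automorphism. $\mathsf{M}$ is (pre)covering if every $R$-module has an $\mathsf{M}$-(pre)cover. $\mathsf{M}$-(pre)envelopes and (pre)enveloping classes are defined dually (reverse all arrows). For a class $\mathsf{M}$ of $R$-modules, ${}^\perp\mathsf{M}=\{X : \mathrm{Ext}^1_R(X,M)=0 \text{ for all } M\in\mathsf{M}\}$ and $\mathsf{M}^\perp=\{Y : \mathrm{Ext}^1_R(M,Y)=0\text{ for all } M\in\mathsf{M}\}$. A cotorsion pair is a pair $(\mathsf{M},\mathsf{N})$ of classes of $R$-modules with $\mathsf{M}={}^\perp\mathsf{N}$ and $\mathsf{M}^\perp=\mathsf{N}$. It is perfect if $\mathsf{M}$ is covering and $\mathsf{N}$ is enveloping. *)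

(* Defs.v *)
From HB Require Import structures.
From mathcomp Require Import all_boot all_algebra boolp.

Set Implicit Arguments.
Unset Strict Implicit.
Unset Printing Implicit Defensive.

Import GRing.Theory.
Local Open Scope ring_scope.

(* Right R-modules are left modules over the converse ring R^c: the right     *)
(* action x r is written (r : R^c) *: x.                                      *)

(* [Num.int_num_subdef] is the zmodClosed predicate behind [Num.int].         *)
Definition QmodZ : zmodType := Quotient.quot (Num.int_num_subdef : {pred rat}).

Section CharacterModule.
Variables (R : pzRingType) (M : lmodType R).

(* Hom_Z(M, Q/Z), with the right R-action (f r)(x) = f (r x).                 *)
Definition char_module : Type := {additive M -> QmodZ}.

Definition char_fun (f : char_module) : {additive M -> QmodZ} := f.

HB.instance Definition _ := gen_eqMixin char_module.
HB.instance Definition _ := gen_choiceMixin char_module.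

Definition char_zero : char_module := \0.
Definition char_opp (f : char_module) : char_module := \- (char_fun f).
Definition char_add (f g : char_module) : char_module :=
  char_fun f \+ char_fun g.
Definition char_scale (r : R^c) (f : char_module) : char_module :=
  char_fun f \o ( *:%R (r : R)).

Lemma char_ext (f g : char_module) : char_fun f =1 char_fun g -> f = g.
Proof.
case: f g => f [[cf]] [g [[cg]]] /= /funext fg; subst g.
by rewrite (Prop_irrelevance cf cg).
Qed.

Lemma char_addA : associative char_add.
Proof. by move=> f g h; apply: char_ext => x /=; rewrite addrA. Qed.

Lemma char_addC : commutative char_add.
Proof. by move=> f g; apply: char_ext => x /=; rewrite addrC. Qed.

Lemma char_add0 : left_id char_zero char_add.
Proof. by move=> f; apply: char_ext => x /=; rewrite add0r. Qed.

Lemma char_addN : left_inverse char_zero char_opp char_add.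
Proof. by move=> f; apply: char_ext => x /=; rewrite addNr. Qed.

HB.instance Definition _ :=
  GRing.isZmodule.Build char_module char_addA char_addC char_add0 char_addN.

Lemma char_scaleA (r s : R^c) (f : char_module) :
  char_scale r (char_scale s f) = char_scale (r * s) f.
Proof. by apply: char_ext => x /=; rewrite scalerA. Qed.

Lemma char_scale1 : left_id (1 : R^c) char_scale.
Proof. by move=> f; apply: char_ext => x /=; rewrite scale1r. Qed.

Lemma char_scaleDr : right_distributive char_scale +%R.
Proof. by move=> r f g; apply: char_ext. Qed.

Lemma char_scaleDl (f : char_module) : {morph char_scale^~ f : r s / r + s}.
Proof. by move=> r s; apply: char_ext => x /=; rewrite scalerDl raddfD. Qed.

HB.instance Definition _ := GRing.Zmodule_isLmodule.Build R^c char_module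
  char_scaleA char_scale1 char_scaleDr char_scaleDl.

End CharacterModule.

Section Exactness.

Definition exact (A B C : zmodType) (f : A -> B) (g : B -> C) : Prop :=
  forall y, g y = 0 <-> exists x, f x = y.

Definition surjective (A B : Type) (f : A -> B) : Prop :=
  forall y, exists x, f x = y.

Definition short_exact (A B C : zmodType) (f : A -> B) (g : B -> C) : Prop :=
  [/\ injective f, exact f g & surjective g].

End Exactness.

Section Tensor.
Variables (R : pzRingType) (X : lmodType R^c) (M : lmodType R).

Record balanced (A : zmodType) (b : X -> M -> A) : Prop := Balanced {
  balancedDl : forall x y m, b (x + y) m = b x m + b y m;
  balancedDr : forall x m n, b x (m + n) = b x m + b x n;
  balancedZ : forall x (r : R) m, b ((r : R^c) *: x) m = b x (r *: m)
}.

(* The abelian group T, with t x m standing for the pure tensor of x and m,   *)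
(* is the tensor product of X and M over R.                                   *)
Definition is_tensor (T : zmodType) (t : X -> M -> T) : Prop :=
  balanced t /\
  forall (A : zmodType) (b : X -> M -> A), balanced b ->
    exists h : {additive T -> A}, (forall x m, h (t x m) = b x m) /\
      forall h' : {additive T -> A}, (forall x m, h' (t x m) = b x m) ->
        h' =1 h.

End Tensor.

(* F and G below are X (x) f and X (x) g for arbitrary choices of the three   *)
(* tensor products.                                                           *)
Definition pure_exact (R : pzRingType) (M' M M'' : lmodType R)
    (f : {linear M' -> M}) (g : {linear M -> M''}) : Prop :=
  short_exact f g /\
  forall (X : lmodType R^c)
    (T' T T'' : zmodType)
    (t' : X -> M' -> T') (t : X -> M -> T) (t'' : X -> M'' -> T''),
    is_tensor t' -> is_tensor t -> is_tensor t'' ->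
  forall (F : {additive T' -> T}) (G : {additive T -> T''}),
    (forall x m, F (t' x m) = t x (f m)) ->
    (forall x m, G (t x m) = t'' x (g m)) ->
    short_exact F G.

Section Ext1.
Variable R : pzRingType.

Definition projective (P : lmodType R) : Prop :=
  forall (A B : lmodType R) (g : {linear A -> B}) (f : {linear P -> B}),
    surjective g -> exists h : {linear P -> A}, forall x, g (h x) = f x.

Definition projective_resolution (X : lmodType R) (P : nat -> lmodType R)
    (d : forall n, {linear P n.+1 -> P n}) (e : {linear P 0%N -> X}) : Prop :=
  [/\ forall n, projective (P n), surjective e, exact (d 0%N) e
    & forall n, exact (d n.+1) (d n)].

(* H^1 (Hom (P, Y)) = 0 for the projective resolutions P of X.                *)
Definition Ext1_eq0 (X Y : lmodType R) : Prop :=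
  forall (P : nat -> lmodType R) (d : forall n, {linear P n.+1 -> P n})
    (e : {linear P 0%N -> X}), projective_resolution d e ->
  forall phi : {linear P 1%N -> Y}, (forall x, phi (d 1%N x) = 0) ->
  exists psi : {linear P 0%N -> Y}, forall x, phi x = psi (d 0%N x).

End Ext1.

Section Classes.
Variable R : pzRingType.
Implicit Types (M : lmodType R -> Prop) (A B S N : lmodType R).

Definition isomorphic A B : Prop := exists f : {linear A -> B}, bijective f.

Definition iso_closed M : Prop := forall A B, isomorphic A B -> M A -> M B.

Definition is_product (I : Type) (F : I -> lmodType R) S
    (p : forall i, {linear S -> F i}) : Prop :=
  forall A (f : forall i, {linear A -> F i}),
    exists h : {linear A -> S}, (forall i x, p i (h x) = f i x) /\
      forall h' : {linear A -> S}, (forall i x, p i (h' x) = f i x) -> h' =1 h.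

Definition is_coproduct (I : Type) (F : I -> lmodType R) S
    (j : forall i, {linear F i -> S}) : Prop :=
  forall A (f : forall i, {linear F i -> A}),
    exists h : {linear S -> A}, (forall i x, h (j i x) = f i x) /\
      forall h' : {linear S -> A}, (forall i x, h' (j i x) = f i x) -> h' =1 h.

Definition closed_under_products M : Prop :=
  forall (I : Type) (F : I -> lmodType R) S (p : forall i, {linear S -> F i}),
    is_product p -> (forall i, M (F i)) -> M S.

Definition closed_under_coproducts M : Prop :=
  forall (I : Type) (F : I -> lmodType R) S (j : forall i, {linear F i -> S}),
    is_coproduct j -> (forall i, M (F i)) -> M S.

Definition closed_under_finite_sums M : Prop :=
  forall (I : finType) (F : I -> lmodType R) S
    (j : forall i, {linear F i -> S}),
    is_coproduct j -> (forall i, M (F i)) -> M S.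

Definition closed_under_summands M : Prop :=
  forall A B S, isomorphic (A * B)%type S -> M S -> M A.

Definition closed_under_extensions M : Prop :=
  forall A B S (f : {linear A -> S}) (g : {linear S -> B}),
    short_exact f g -> M A -> M B -> M S.

(* Closure under pure submodules, pure quotients and pure extensions.         *)
Definition pure_closed M : Prop :=
  forall A B S (f : {linear A -> S}) (g : {linear S -> B}),
    pure_exact f g -> (M S <-> M A /\ M B).

Definition is_precover M A N (phi : {linear A -> N}) : Prop :=
  M A /\ forall A', M A' -> forall phi' : {linear A' -> N},
    exists psi : {linear A' -> A}, forall x, phi' x = phi (psi x).

Definition is_cover M A N (phi : {linear A -> N}) : Prop :=
  is_precover M phi /\
  forall psi : {linear A -> A}, (forall x, phi x = phi (psi x)) ->
    bijective psi.

Definition is_preenvelope M A N (phi : {linear N -> A}) : Prop :=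
  M A /\ forall A', M A' -> forall phi' : {linear N -> A'},
    exists psi : {linear A -> A'}, forall x, phi' x = psi (phi x).

Definition is_envelope M A N (phi : {linear N -> A}) : Prop :=
  is_preenvelope M phi /\
  forall psi : {linear A -> A}, (forall x, phi x = psi (phi x)) ->
    bijective psi.

Definition covering M : Prop :=
  forall N, exists A (phi : {linear A -> N}), is_cover M phi.

Definition preenveloping M : Prop :=
  forall N, exists A (phi : {linear N -> A}), is_preenvelope M phi.

Definition enveloping M : Prop :=
  forall N, exists A (phi : {linear N -> A}), is_envelope M phi.

Definition left_perp M : lmodType R -> Prop :=
  fun X => forall A, M A -> Ext1_eq0 X A.

Definition right_perp M : lmodType R -> Prop :=
  fun Y => forall A, M A -> Ext1_eq0 A Y.

Definition cotorsion_pair (M N : lmodType R -> Prop) : Prop :=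
  (forall A, M A <-> left_perp N A) /\ (forall A, right_perp M A <-> N A).

Definition perfect_cotorsion_pair (M N : lmodType R -> Prop) : Prop :=
  [/\ cotorsion_pair M N, covering M & enveloping N].

End Classes.

Section DualityPairs.
Variable R : pzRingType.
Implicit Types (M : lmodType R -> Prop) (C : lmodType R^c -> Prop).

Record duality_pair M C : Prop := DualityPair {
  duality_pair_isol : iso_closed M;
  duality_pair_isor : iso_closed C;
  duality_pair_char : forall A : lmodType R, M A <-> C (char_module A);
  duality_pair_summands : closed_under_summands C;
  duality_pair_sums : closed_under_finite_sums C
}.

Definition product_closed M C : Prop :=
  duality_pair M C /\ closed_under_products M.

Definition coproduct_closed M C : Prop :=
  duality_pair M C /\ closed_under_coproducts M.

Definition perfect_duality_pair M C : Prop :=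
  [/\ coproduct_closed M C, closed_under_extensions M & M R^o].

End DualityPairs.

(* Main.v *)
(* A sequence 0 -> A -> S -> B -> 0 whose character sequence splits satisfies   *)
(* S^+ = A^+ (+) B^+, so that S is in M iff A and B are. Purity provides the   *)
(* splitting: tensoring with A^+, or by a limit of local sections of S -> B.  *)
(*                                                                            *)
(* (a) Every image of N in a module of M lies in a pure submodule of bounded  *)
(* size; take the product of the maps from N to bounded modules of M.         *)
(*                                                                            *)
(* (b) For f : A -> N, let P be maximal among the pure submodules of A inside *)
(* ker f. If A/P were larger than a bound depending only on N and R, then two *)
(* copies over N of a small pure submodule would yield a nonzero pure         *)
(* submodule {b - theta b} in the kernel of A/P -> N. Hence the sum of the    *)
(* maps to N from bounded modules of M is a precover. As M is closed under    *)
(* directed colimits, transfinite iteration of endomorphisms (Enochs) turns   *)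
(* it into a cover: in a category with directed colimits and a weakly         *)
(* terminal object there is one all of whose endomorphisms are bijective.     *)
(*                                                                            *)
(* (c) The same principle, for the category of the extensions                 *)
(* 0 -> N -> Y -> A -> 0 with A in M, gives the envelopes. Covers have their  *)
(* kernel in the right orthogonal class (Wakamatsu), so that a module in the  *)
(* left orthogonal of this class is a summand of its cover.                   *)

Require Import Defs.
From HB Require Import structures.
From mathcomp Require Import all_boot all_algebra boolp.
From mathcomp Require Import classical_sets functions wochoice.

Set Implicit Arguments.
Unset Strict Implicit.
Unset Printing Implicit Defensive.

Import GRing.Theory.
Local Open Scope ring_scope.

(** * The group Q/Z *)

Local Open Scope quotient_scope.

(** Duality turns purity into splitting. If the dual of 0 -> A -> S -> B -> 0 splits, S^+ is the sum
    of A^+ and B^+, and the closure properties of C, read back through the duality, give S in M iff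
    A and B are in M ([char_retraction_closed]). The splitting comes from the tensor definition of
    purity ([pure_exact_char_section]), or from sections of S -> B that respect any given finite set
    of relations ([pure_epi_char_retraction]). Both rest on the injectivity of Q/Z
    ([QmodZ_extension]).

    Sizes are bounded by surjections from types of terms instead of cardinals. Maps from N into
    modules of M factor through bounded pure submodules, and maps from modules of M to N through
    bounded pure quotients ([factor_bounded]); a product, respectively a direct sum, over all
    bounded modules of M with a map is then a preenvelope, respectively a precover.

    A directed colimit is a pure quotient of a direct sum, so M is closed under the colimits of
    [colim_exists]. This allows transfinite iteration of endomorphisms, and [minimal_object] yields
    a weakly terminal object with bijective endomorphisms only. For modules of M over N this is a
    cover; for extensions 0 -> N -> Y -> A -> 0 with A in M it is an envelope in the right
    orthogonal class ([minimal_under_right_perp]). Wakamatsu's lemma [cover_kernel_right_perp]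
    closes the cotorsion pair. *)

Definition QmodZ_pi : {additive rat -> QmodZ} :=
  \pi_(Quotient.quot (Num.int_num_subdef : {pred rat})).

Lemma QmodZ_pi_surj (y : QmodZ) : exists a, QmodZ_pi a = y.
Proof.
exists (repr (y : Quotient.quot (Num.int_num_subdef : {pred rat}))).
exact: reprK.
Qed.

Lemma QmodZ_pi_eq0 a : (QmodZ_pi a == 0) = (a \is a Num.int).
Proof.
have := Quotient.idealrBE (Num.int_num_subdef : {pred rat}) a 0.
rewrite subr0 => E; rewrite [RHS]E.
by rewrite -(raddf0 QmodZ_pi).
Qed.

Definition mkAdd (A B : zmodType) (f : A -> B) (Hf : zmod_morphism f) :
  {additive A -> B} := HB.pack f (GRing.isZmodMorphism.Build A B f Hf).

Definition mkLin (R : pzRingType) (A B : lmodType R) (f : A -> B)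
    (Hf : linear f) : {linear A -> B} :=
  HB.pack f (GRing.isLinear.Build R A B *:%R f Hf).

(** [Zorn_bigcup] also tests the empty chain. Adjoining [G] to every set turns the union of that
    chain into [G], where [P] is known. *)
Lemma Zorn_above (T : Type) (P : set (set T)) (G : set T) :
  P G ->
  (forall F : set (set T), (exists X, F X) -> (forall X, F X -> P X) ->
    (forall X Y, F X -> F Y -> (X `<=` Y \/ Y `<=` X)%classic) ->
    P (fun x => exists2 X, F X & X x)) ->
  exists A, [/\ P A, (G `<=` A)%classic
    & forall B, P B -> (A `<=` B)%classic -> (B `<=` A)%classic].
Proof.
move=> PG Pchain; pose P' (A : set T) := P (A `|` G)%classic.
suff /Zorn_bigcup[A [PA maxA]] : forall F, (F `<=` P')%classic ->
    total_on F subset -> P' (\bigcup_(X in F) X)%classic.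
  exists (A `|` G)%classic; split=> // B PB AB x Bx.
  apply: contrapT => nAx; apply: (maxA B).
    split=> [y Ay|BA]; first by apply: AB; left.
    by apply: nAx; left; exact: BA.
  suff -> : P' B = P B by [].
  rewrite /P' (_ : B `|` G = B)%classic //.
  by apply/setUidPl => y Gy; apply: AB; right.
move=> F FP totF.
have [[X0 FX0]|nF] := pselect (exists X, F X); last first.
  rewrite /P' (_ : _ `|` _ = G)%classic //; apply/setUidPr => x [X FX].
  by case: nF; exists X.
have -> : P' (\bigcup_(X in F) X)%classic =
    P (fun x => exists2 X,
      (fun X => exists2 Y, F Y & X = (Y `|` G)%classic) X & X x).
  congr P; apply/seteqP; split=> x /=.
    case=> [[X FX Xx]|Gx]; first by exists (X `|` G)%classic; [exists X|left].
    by exists (X0 `|` G)%classic; [exists X0|right].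
  by case=> _ [Y FY ->] [Yx|Gx]; [left; exists Y|right].
apply: Pchain; first by exists (X0 `|` G)%classic, X0.
  by move=> _ [Y FY ->]; exact: FP.
move=> _ _ [X FX ->] [Y FY ->].
by have [XY|YX] := totF _ _ FX FY; [left|right] => x [?|?]; by [left; auto|right].
Qed.

Lemma QmodZ_divisible (y : QmodZ) n : (0 < n)%N -> exists q : QmodZ, q *+ n = y.
Proof.
move=> n_gt0; have [a <-] := QmodZ_pi_surj y.
exists (QmodZ_pi (a / n%:R)); rewrite -(raddfMn QmodZ_pi); congr (QmodZ_pi _).
rewrite -[LHS]mulr_natr divfK //.
by rewrite Num.Theory.pnatr_eq0 -lt0n.
Qed.

Section QmodZExtension.
Variable B : zmodType.

(** These are the graphs of the homomorphisms to Q/Z defined on subgroups of B. *)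
Definition fun_subgroup (G : set (B * QmodZ)) : Prop :=
  [/\ G (0, 0),
      forall x y x' y', G (x, y) -> G (x', y') -> G (x - x', y - y')
    & forall y, G (0, y) -> y = 0].

Lemma fun_subgroupMz G x y k : fun_subgroup G -> G (x, y) ->
  G (x *~ k, y *~ k).
Proof.
case=> G0 GB _ Gxy; have GN u v : G (u, v) -> G (- u, - v).
  by move=> Guv; rewrite -[- u]add0r -[- v]add0r; exact: GB.
have Gn n : G (x *+ n, y *+ n).
  elim: n => [|n IH]; first by rewrite !mulr0n.
  by rewrite !mulrSr; have := GB _ _ _ _ IH (GN _ _ Gxy); rewrite !opprK.
by case: k => n; [exact: Gn|rewrite NegzE !mulrNz; exact/GN/Gn].
Qed.

(* The value at [b] is forced by the least positive multiple of [b] in the     *)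
(* domain, and can be chosen because Q/Z is divisible.                        *)
Lemma fun_subgroup_value G (b : B) : fun_subgroup G ->
  exists q, forall k y, G (b *~ k, y) -> q *~ k = y.
Proof.
move=> HG; have [G0 GB Gf] := HG.
have Guniq x y z : G (x, y) -> G (x, z) -> y = z.
  move=> Gy Gz; apply/eqP; rewrite -subr_eq0; apply/eqP/Gf.
  by rewrite -(subrr x); exact: GB.
pose D n := `[< (0 < n)%N /\ exists y, G (b *+ n, y) >].
have [[n0 Dn0]|nD] := pselect (exists n, D n); last first.
  exists 0 => k y; have [->|k0] := eqVneq k 0.
    by rewrite !mulr0z => /Gf.
  case: k k0 => n k0 Gky; case: nD.
    by exists n; apply/asboolP; split; [rewrite lt0n|exists y].
  exists n.+1; apply/asboolP; split=> //; exists (- y).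
  by have := GB _ _ _ _ G0 Gky; rewrite !sub0r NegzE mulrNz opprK.
have exD : exists n, D n by exists n0.
case: (ex_minnP exD) => d /asboolP[d_gt0 [yd Gd]] mind.
have [q qd] := QmodZ_divisible yd d_gt0.
exists q => k y Gk; have d0 : d%:Z != 0 by rewrite -lt0n.
have [m [r [kE r_lt]]] : exists m (r : nat), k = m * d%:Z + r%:Z /\ (r < d)%N.
  exists (k %/ d)%Z, `|(k %% d)%Z|%N; rewrite gez0_abs ?modz_ge0 //.
  split; first exact: divz_eq.
  by rewrite -ltz_nat gez0_abs ?modz_ge0 // ltz_pmod.
have Gr : G (b *+ r, y - yd *~ m).
  have -> : b *+ r = b *~ k - (b *+ d) *~ m.
    by rewrite kE mulrzDr [m * _]mulrC mulrzA addrAC subrr add0r.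
  by apply: GB => //; apply: fun_subgroupMz.
have r0 : r = 0%N.
  apply/eqP; rewrite -leqn0 leqNgt; apply/negP => r_gt0.
  have /mind : D r; last by rewrite leqNgt r_lt.
  by apply/asboolP; split=> //; exists (y - yd *~ m).
rewrite kE r0 addr0 mulrC mulrzA -[q *~ d]/(q *+ d) qd.
apply/esym/eqP; rewrite -subr_eq0; apply/eqP/Gf.
by move: Gr; rewrite r0 mulr0n.
Qed.

(** Injectivity of Q/Z: a maximal graph above [G] is total, because [fun_subgroup_value] allows any
    further element to be adjoined to its domain. *)
Lemma QmodZ_extension (G : set (B * QmodZ)) : fun_subgroup G ->
  exists g : {additive B -> QmodZ}, forall x y, G (x, y) -> g x = y.
Proof.
move=> HG; have [|A [HA GA maxA]] := Zorn_above HG.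
  move=> F [X0 FX0] FP Ftot; have [X00 _ _] := FP _ FX0; split.
  - by exists X0.
  - move=> x y x' y' [X FX Xx] [Y FY Yx].
    have [XY|YX] := Ftot _ _ FX FY; [exists Y|exists X] => //.
      by have [_ + _] := FP _ FY; apply=> //; exact: XY.
    by have [_ + _] := FP _ FX; apply=> //; exact: YX.
  - by move=> y [X FX Xy]; have [_ _] := FP _ FX; exact.
have [A0 AB Af] := HA.
have Atot b : exists q, A (b, q).
  have [q qP] := fun_subgroup_value b HA; exists q.
  pose A' : set (B * QmodZ) := fun p =>
    exists x y k, [/\ A (x, y), p.1 = x + b *~ k & p.2 = y + q *~ k].
  apply: (maxA A'); last 1 first.
  - by exists 0, 0, 1; split=> //=; rewrite add0r.
  - split.
    + by exists 0, 0, 0; split=> //=; rewrite mulr0z addr0.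
    + move=> _ _ _ _ [x [y [k [/= Axy -> ->]]]] [x' [y' [k' [/= Axy' -> ->]]]].
      exists (x - x'), (y - y'), (k - k'); rewrite !mulrzBr; split=> /=.
      * exact: AB.
      * by rewrite opprD addrACA.
      * by rewrite opprD addrACA.
    + move=> z [x [y [k [/= Axy E ->]]]].
      rewrite (qP k (- y)) ?subrr //.
      have -> : b *~ k = 0 - x by apply/eqP; rewrite eq_sym subr_eq addrC E.
      by rewrite -[- y]add0r; exact: AB.
  - move=> [x y] Axy; exists x, y, 0; rewrite !mulr0z !addr0; split=> //.
have [g gP] := choice Atot.
have Auniq x y z : A (x, y) -> A (x, z) -> y = z.
  move=> Ay Az; apply/eqP; rewrite -subr_eq0; apply/eqP/Af.
  by rewrite -(subrr x); exact: AB.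
have gB : zmod_morphism g.
  by move=> x y; apply: (Auniq (x - y)) => //; exact: AB.
by exists (mkAdd gB) => x y /GA Axy; exact: (Auniq x).
Qed.

(** On the cyclic group generated by [b], send [b] to the class of 1/d if it has finite order d, and
    to that of 1/2 otherwise; then extend. *)
Lemma QmodZ_separates (b : B) : b <> 0 ->
  exists chi : {additive B -> QmodZ}, chi b <> 0.
Proof.
move=> b0; have [q [q0 qP]] : exists q : QmodZ, q <> 0 /\
    forall k : int, b *~ k = 0 -> q *~ k = 0.
  pose D n := (0 < n)%N && (b *+ n == 0).
  have mulrz_abs (k : int) : b *~ k = 0 -> b *+ `|k|%N = 0.
    case: k => n // /eqP; rewrite NegzE mulrNz oppr_eq0 => /eqP.
    by rewrite abszN.
  have piM (a : rat) (k : int) : QmodZ_pi a *~ k = QmodZ_pi (a * k%:~R).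
    by rewrite -raddfMz mulrzr.
  have [[n0 Dn0]|nD] := pselect (exists n, D n); last first.
    exists (QmodZ_pi (1 / 2%:R)); split.
      by move/eqP; rewrite QmodZ_pi_eq0.
    move=> k; have [->|k0] := eqVneq k 0; first by rewrite mulr0z.
    move=> bk; case: nD; exists `|k|%N; rewrite /D absz_gt0 k0 /=.
    by rewrite mulrz_abs.
  have exD : exists n, D n by exists n0.
  case: (ex_minnP exD) => d /andP[d_gt0 /eqP bd] mind.
  have dR : d%:R != 0 :> rat by rewrite Num.Theory.pnatr_eq0 -lt0n.
  exists (QmodZ_pi (1 / d%:R)); split.
    move/eqP; rewrite QmodZ_pi_eq0 => /Num.Theory.intrP[m mE].
    have dm : (d%:Z * m)%R = 1.
      apply: (@intr_inj rat); rewrite rmorphM /= -mE.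
      by rewrite mulrCA mulfV // mulr1.
    have d1 : d = 1%N.
      have /eqP := congr1 absz dm; rewrite abszM /= muln_eq1.
      by case/andP => /eqP.
    by apply: b0; rewrite -bd d1.
  move=> k bk; have : (d %| `|k|)%N.
    have bk' : b *+ `|k|%N = 0.
      exact: mulrz_abs.
    rewrite /dvdn; apply: contraT; rewrite -lt0n => r_gt0.
    have /mind : D (`|k| %% d)%N; last by rewrite leqNgt ltn_pmod.
    rewrite /D r_gt0 /=; apply/eqP; move: bk'.
    by rewrite {1}(divn_eq `|k|%N d) mulrnDr mulnC mulrnA bd mul0rn add0r.
  move=> dk; have /dvdzP[m ->] : (d %| k)%Z by rewrite dvdzE.
  apply/eqP; rewrite piM QmodZ_pi_eq0 rmorphM /= mul1r mulrCA mulVf // mulr1.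
  exact: Num.Theory.intr_int.
pose G : set (B * QmodZ) := fun p =>
  exists k : int, p.1 = b *~ k /\ p.2 = q *~ k.
have HG : fun_subgroup G.
  split.
  - by exists 0.
  - move=> _ _ _ _ [k [/= -> ->]] [k' [/= -> ->]]; exists (k - k').
    by rewrite /= !mulrzBr.
  - by move=> y [k [/= E ->]]; exact: qP.
have [g gP] := QmodZ_extension HG; exists g.
by rewrite (gP b q) //; exists 1.
Qed.

End QmodZExtension.

Lemma char_extend (A B : zmodType) (i : {additive A -> B})
    (f : {additive A -> QmodZ}) : injective i ->
  exists g : {additive B -> QmodZ}, forall a, g (i a) = f a.
Proof.
move=> inj_i; pose G : set (B * QmodZ) := fun p => exists a, p = (i a, f a).
have HG : fun_subgroup G.
  split.
  - by exists 0; rewrite !raddf0.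
  - by move=> _ _ _ _ [a [-> ->]] [a' [-> ->]]; exists (a - a'); rewrite !raddfB.
  - move=> y [a [E ->]]; have -> : a = 0; last exact: raddf0.
    by apply: inj_i; rewrite -E raddf0.
by have [g gP] := QmodZ_extension HG; exists g => a; apply: gP; exists a.
Qed.

(** * Submodules, quotients and homomorphisms *)

Section Submodules.
Variables (R : pzRingType) (V : lmodType R).

Record submod := Submod {
  submod_set :> V -> Prop;
  submod_set0 : submod_set 0;
  submod_setP : forall a x y,
    submod_set x -> submod_set y -> submod_set (a *: x + y)
}.

Variable W : submod.

Lemma submodZ a x : W x -> W (a *: x).
Proof. by move=> Wx; rewrite -[_ *: _]addr0; apply: submod_setP (submod_set0 W). Qed.

Definition submod_pred : {pred V} := fun x => `[< W x >].

Lemma submod_pred_closed : submod_closed submod_pred.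
Proof.
split=> [|a x y /asboolP Wx /asboolP Wy]; apply/asboolP.
  exact: submod_set0.
exact: submod_setP.
Qed.

HB.instance Definition _ :=
  GRing.isSubmodClosed.Build R V submod_pred submod_pred_closed.

Record subm := Subm { subm_val :> V; subm_valP : subm_val \in submod_pred }.

HB.instance Definition _ := [isSub for subm_val].
HB.instance Definition _ := [Choice of subm by <:].
HB.instance Definition _ := [SubChoice_isSubLmodule of subm by <:].

Definition subm_incl : {linear subm -> V} := mkLin (linearP (val : subm -> V)).

Lemma subm_incl_inj : injective subm_incl.
Proof. exact: val_inj. Qed.

Lemma subm_inclP x : W (subm_incl x).
Proof. exact/asboolP/(valP x). Qed.

Lemma subm_incl_surj x : W x -> exists y, subm_incl y = x.
Proof. by move=> /asboolP Wx; exists (Subm Wx). Qed.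

Local Open Scope quotient_scope.

Definition quotm := Quotient.quot submod_pred.

HB.instance Definition _ := GRing.Zmodule.on quotm.

Definition quotm_pi (x : V) : quotm := \pi_(Quotient.quot submod_pred) x.

Definition quotm_scale (a : R) (q : quotm) : quotm :=
  quotm_pi (a *: (repr (q : Quotient.quot submod_pred))).

Lemma quotm_piE x y : quotm_pi x = quotm_pi y <-> W (x - y).
Proof.
split=> [/eqP|Wxy].
  by rewrite /quotm_pi -Quotient.idealrBE => /asboolP.
by apply/eqP; rewrite /quotm_pi -Quotient.idealrBE; apply/asboolP.
Qed.

Lemma quotm_pi_surj q : exists x, quotm_pi x = q.
Proof. by exists (repr (q : Quotient.quot submod_pred)); exact: reprK. Qed.

Lemma quotm_piB : zmod_morphism quotm_pi.
Proof. by move=> x y; rewrite /quotm_pi raddfB. Qed.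

Lemma quotm_piD : {morph quotm_pi : x y / x + y}.
Proof. exact: (raddfD (mkAdd quotm_piB)). Qed.

Lemma quotm_scaleE a x : quotm_scale a (quotm_pi x) = quotm_pi (a *: x).
Proof.
rewrite /quotm_scale; apply/quotm_piE; rewrite -scalerBr; apply: submodZ.
by apply/quotm_piE; exact: reprK.
Qed.

Lemma quotm_scaleA a b q :
  quotm_scale a (quotm_scale b q) = quotm_scale (a * b) q.
Proof. by have [x <-] := quotm_pi_surj q; rewrite !quotm_scaleE scalerA. Qed.

Lemma quotm_scale1 : left_id 1 quotm_scale.
Proof.
by move=> q; have [x <-] := quotm_pi_surj q; rewrite quotm_scaleE scale1r.
Qed.

Lemma quotm_scaleDr : right_distributive quotm_scale +%R.
Proof.
move=> a p q; have [x <-] := quotm_pi_surj p; have [y <-] := quotm_pi_surj q.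
by rewrite -quotm_piD !quotm_scaleE scalerDr quotm_piD.
Qed.

Lemma quotm_scaleDl q : {morph quotm_scale^~ q : a b / a + b}.
Proof.
move=> a b; have [x <-] := quotm_pi_surj q.
by rewrite !quotm_scaleE scalerDl quotm_piD.
Qed.

HB.instance Definition _ := GRing.Zmodule_isLmodule.Build R quotm
  quotm_scaleA quotm_scale1 quotm_scaleDr quotm_scaleDl.

Lemma quotm_pi_linear : linear quotm_pi.
Proof. by move=> a x y; rewrite quotm_piD -quotm_scaleE. Qed.

Definition quotm_proj : {linear V -> quotm} := mkLin quotm_pi_linear.

Lemma quotm_proj_surj : surjective quotm_proj.
Proof. exact: quotm_pi_surj. Qed.

Lemma quotm_proj_eq0 x : quotm_proj x = 0 <-> W x.
Proof.
have := quotm_piE x 0; rewrite subr0 => <-.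
by rewrite -(raddf0 quotm_proj).
Qed.

Lemma subm_quotm_exact : short_exact subm_incl quotm_proj.
Proof.
split; [exact: subm_incl_inj| |exact: quotm_proj_surj] => x.
rewrite quotm_proj_eq0; split=> [|[y <-]]; last exact: subm_inclP.
exact: subm_incl_surj.
Qed.

End Submodules.

Section Homomorphisms.
Variable R : pzRingType.
Implicit Types A B C : lmodType R.

(** Serves to define a homomorphism through presentations of elements, as in quotients, direct sums
    and colimits: well-definedness has to be checked at 0 only. *)
Lemma linear_of_rel A B (G : A -> B -> Prop) :
  (forall x, exists y, G x y) ->
  (forall a x y x' y', G x y -> G x' y' -> G (a *: x + x') (a *: y + y')) ->
  (forall y, G 0 y -> y = 0) ->
  exists h : {linear A -> B}, forall x y, G x y -> h x = y.
Proof.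
move=> Gtot GP Gf; have [h hP] := choice Gtot.
have Gu x y z : G x y -> G x z -> y = z.
  move=> Gy Gz; apply/eqP; rewrite -subr_eq0 addrC -scaleN1r; apply/eqP/Gf.
  by have := GP (-1) _ _ _ _ Gz Gy; rewrite !scaleN1r addNr.
have hL : linear h by move=> a x y; apply: (Gu (a *: x + y)) => //; exact: GP.
by exists (mkLin hL) => x y Gxy; exact: (Gu x).
Qed.

Lemma factor_surj A B C (p : {linear A -> B}) (f : {linear A -> C}) :
  surjective p -> (forall x, p x = 0 -> f x = 0) ->
  exists h : {linear B -> C}, forall x, h (p x) = f x.
Proof.
move=> sp kp; have [|a y z y' z' [x <- <-] [x' <- <-]|z [x px <-]|h hP] :=
  @linear_of_rel B C (fun y z => exists2 x, p x = y & f x = z).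
- by move=> y; have [x <-] := sp y; exists (f x), x.
- by exists (a *: x + x'); rewrite linearP.
- exact: kp.
by exists h => x; apply: hP; exists x.
Qed.

Lemma factor_inj A B C (i : {linear A -> B}) (f : {linear C -> B}) :
  injective i -> (forall c, exists a, i a = f c) ->
  exists h : {linear C -> A}, forall c, i (h c) = f c.
Proof.
move=> inj_i /choice[h hP]; have hL : linear h.
  by move=> a x y; apply: inj_i; rewrite linearP !hP linearP.
by exists (mkLin hL).
Qed.

Lemma bijective_inj_surj (T U : Type) (f : T -> U) :
  injective f -> surjective f -> bijective f.
Proof.
move=> inj_f /choice[g gP]; exists g => // x.
by apply: inj_f; rewrite gP.
Qed.

Lemma isomorphic_sym A B : isomorphic A B -> isomorphic B A.
Proof.
case=> f [g fK gK]; have gL : linear g.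
  by move=> a x y; apply: (can_inj fK); rewrite linearP !gK.
by exists (mkLin gL), f.
Qed.

Lemma linear_ker_inj A B (f : {linear A -> B}) :
  (forall x, f x = 0 -> x = 0) -> injective f.
Proof.
move=> kf x y fxy; apply/eqP; rewrite -subr_eq0; apply/eqP/kf.
by rewrite linearB fxy subrr.
Qed.

Definition ker_submod A B (f : {linear A -> B}) : submod A.
Proof.
exists (fun x => f x = 0) => [|a x y fx fy]; first exact: raddf0.
by rewrite linearP fx fy scaler0 addr0.
Defined.

End Homomorphisms.

(** * Injective cogenerators, products and direct sums *)

Section Coinduced.
Variable R : pzRingType.

(* Hom_Z(R, Q/Z) with the left action (r f)(x) = f(x r); it is injective and   *)
(* cogenerates the category of R-modules.                                     *)
Definition coind : Type := char_module R^o.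

HB.instance Definition _ := GRing.Zmodule.on coind.

Lemma mulr_zmod_morphism (r : R) : zmod_morphism (fun x : R^o => (x * r : R^o)).
Proof. by move=> x y; rewrite mulrBl. Qed.

Definition coind_scale (r : R) (f : coind) : coind :=
  char_fun f \o mkAdd (mulr_zmod_morphism r).

Lemma coind_scaleA r s f : coind_scale r (coind_scale s f) = coind_scale (r * s) f.
Proof. by apply: char_ext => x /=; rewrite mulrA. Qed.

Lemma coind_scale1 : left_id 1 coind_scale.
Proof. by move=> f; apply: char_ext => x /=; rewrite mulr1. Qed.

Lemma coind_scaleDr : right_distributive coind_scale +%R.
Proof. by move=> r f g; apply: char_ext. Qed.

Lemma coind_scaleDl f : {morph coind_scale^~ f : r s / r + s}.
Proof. by move=> r s; apply: char_ext => x /=; rewrite mulrDr raddfD. Qed.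

HB.instance Definition _ := GRing.Zmodule_isLmodule.Build R coind
  coind_scaleA coind_scale1 coind_scaleDr coind_scaleDl.

Variable X : lmodType R.

Lemma coind_of_char_zmod (chi : {additive X -> QmodZ}) (x : X) :
  zmod_morphism (fun a : R^o => chi ((a : R) *: x)).
Proof. by move=> a b; rewrite scalerBl raddfB. Qed.

Lemma coind_of_char_linear (chi : {additive X -> QmodZ}) :
  linear (fun x => mkAdd (coind_of_char_zmod chi x) : coind).
Proof.
move=> a x y; apply: char_ext => b /=.
by rewrite scalerDr raddfD scalerA.
Qed.

(** With [char_of_coind], the adjunction between Hom_R(X, Hom_Z(R, Q/Z)) and Hom_Z(X, Q/Z). It
    transports injectivity and separation of points from Q/Z to [coind]. *)
Definition coind_of_char (chi : {additive X -> QmodZ}) : {linear X -> coind} :=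
  mkLin (coind_of_char_linear chi).

Lemma char_of_coind_zmod (f : {linear X -> coind}) :
  zmod_morphism (fun x => char_fun (f x) 1).
Proof. by move=> x y; rewrite linearB. Qed.

Definition char_of_coind (f : {linear X -> coind}) : {additive X -> QmodZ} :=
  mkAdd (char_of_coind_zmod f).

Lemma coind_separates (x : X) : x <> 0 ->
  exists f : {linear X -> coind}, f x <> 0.
Proof.
move=> /QmodZ_separates[chi chix]; exists (coind_of_char chi).
move=> /(congr1 (fun f : coind => char_fun f 1)) /= E; apply: chix.
by rewrite -[x]scale1r E.
Qed.

End Coinduced.

Lemma coind_extend (R : pzRingType) (X Y : lmodType R) (i : {linear X -> Y})
    (f : {linear X -> coind R}) : injective i ->
  exists g : {linear Y -> coind R}, forall x, g (i x) = f x.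
Proof.
move=> inj_i; have [chi chiP] := @char_extend X Y i (char_of_coind f) inj_i.
exists (coind_of_char chi) => x; apply: char_ext => a /=.
by rewrite -linearZ chiP /= linearZ /= mul1r.
Qed.

Section Products.
Variables (R : pzRingType) (I : Type) (F : I -> lmodType R).

Definition dprod : Type := forall i, F i.

HB.instance Definition _ := gen_eqMixin dprod.
HB.instance Definition _ := gen_choiceMixin dprod.

Definition dprod_zero : dprod := fun=> 0.
Definition dprod_opp (x : dprod) : dprod := fun i => - x i.
Definition dprod_add (x y : dprod) : dprod := fun i => x i + y i.
Definition dprod_scale (r : R) (x : dprod) : dprod := fun i => r *: x i.

Lemma dprod_addA : associative dprod_add.
Proof. by move=> x y z; apply: functional_extensionality_dep => i; exact: addrA. Qed.

Lemma dprod_addC : commutative dprod_add.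
Proof. by move=> x y; apply: functional_extensionality_dep => i; exact: addrC. Qed.

Lemma dprod_add0 : left_id dprod_zero dprod_add.
Proof. by move=> x; apply: functional_extensionality_dep => i; exact: add0r. Qed.

Lemma dprod_addN : left_inverse dprod_zero dprod_opp dprod_add.
Proof. by move=> x; apply: functional_extensionality_dep => i; exact: addNr. Qed.

HB.instance Definition _ :=
  GRing.isZmodule.Build dprod dprod_addA dprod_addC dprod_add0 dprod_addN.

Lemma dprod_scaleA a b x : dprod_scale a (dprod_scale b x) = dprod_scale (a * b) x.
Proof. by apply: functional_extensionality_dep => i; exact: scalerA. Qed.

Lemma dprod_scale1 : left_id 1 dprod_scale.
Proof. by move=> x; apply: functional_extensionality_dep => i; exact: scale1r. Qed.

Lemma dprod_scaleDr : right_distributive dprod_scale +%R.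
Proof. by move=> a x y; apply: functional_extensionality_dep => i; exact: scalerDr. Qed.

Lemma dprod_scaleDl x : {morph dprod_scale^~ x : a b / a + b}.
Proof. by move=> a b; apply: functional_extensionality_dep => i; exact: scalerDl. Qed.

HB.instance Definition _ := GRing.Zmodule_isLmodule.Build R dprod
  dprod_scaleA dprod_scale1 dprod_scaleDr dprod_scaleDl.

Lemma dprod_proj_linear i : linear (fun x : dprod => x i).
Proof. by []. Qed.

Definition dprod_proj i : {linear dprod -> F i} := mkLin (@dprod_proj_linear i).

Lemma dprod_is_product : is_product dprod_proj.
Proof.
move=> A f; have hL : linear (fun a => (fun i => f i a) : dprod).
  by move=> r a b; apply: functional_extensionality_dep => i; rewrite linearP.
exists (mkLin hL); split=> // h' hP a; apply: functional_extensionality_dep => i.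
exact: hP.
Qed.

End Products.

Section DirectSums.
Variables (R : pzRingType) (I : Type) (F : I -> lmodType R).

(* The direct sum is realised as the module of functions on the families of    *)
(* homomorphisms F_i -> Hom_Z(R, Q/Z) generated by the evaluations: since      *)
(* these homomorphisms separate points, relations between evaluations hold in  *)
(* every module.                                                              *)
Definition cofamily : Type := forall i, {linear F i -> coind R}.

Definition cofamily_eval i (a : F i) : cofamily -> coind R := fun chi => chi i a.

Definition dsum_submod : submod (cofamily -> coind R).
Proof.
exists (fun u => exists s : seq {i & F i},
  u = \sum_(p <- s) cofamily_eval (tagged p)).
  by exists [::]; rewrite big_nil.
move=> a _ _ [s ->] [t ->].
exists ([seq existT (fun i => F i) (tag p) (a *: (tagged p : F (tag p)))
         | p : {i & F i} <- s] ++ t).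
rewrite big_cat big_map /= scaler_sumr; congr (_ + _); apply: eq_bigr => p _.
by apply/funext => chi; rewrite /cofamily_eval /= linearZ.
Defined.

Definition dsum : lmodType R := subm dsum_submod.

Lemma dsum_eval_subproof i (a : F i) : dsum_submod (cofamily_eval a).
Proof. by exists [:: existT (fun i => F i) i a]; rewrite big_seq1. Qed.

Definition dsum_in_fun i (a : F i) : dsum :=
  Subm (asboolT (dsum_eval_subproof a)).

Lemma dsum_in_linear i : linear (@dsum_in_fun i).
Proof.
move=> r a b; apply: val_inj; rewrite linearP /=.
by apply/funext => chi; rewrite /cofamily_eval /= linearP.
Qed.

Definition dsum_in i : {linear F i -> dsum} := mkLin (@dsum_in_linear i).

Lemma dsum_gen (u : dsum) :
  exists s : seq {i & F i}, u = \sum_(p <- s) dsum_in (tag p) (tagged p).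
Proof.
have [s sE] := subm_inclP u; exists s; apply: subm_incl_inj.
by rewrite sE linear_sum.
Qed.

Lemma dsum_ext (B : lmodType R) (h h' : {linear dsum -> B}) :
  (forall i a, h (dsum_in i a) = h' (dsum_in i a)) -> h =1 h'.
Proof.
by move=> hh u; have [s ->] := dsum_gen u; rewrite !linear_sum; exact: eq_bigr.
Qed.

Lemma dsum_univ (B : lmodType R) (f : forall i, {linear F i -> B}) :
  exists h : {linear dsum -> B}, forall i a, h (dsum_in i a) = f i a.
Proof.
have [|r _ _ _ _ [s [-> ->]] [t [-> ->]]|y [s [s0 ->]]|h hP] :=
  @linear_of_rel R dsum B (fun u y => exists s : seq {i & F i},
    u = \sum_(p <- s) dsum_in (tag p) (tagged p) /\
    y = \sum_(p <- s) f (tag p) (tagged p)).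
- move=> u; have [s sE] := dsum_gen u.
  by exists (\sum_(p <- s) f (tag p) (tagged p)), s.
- exists ([seq existT (fun i => F i) (tag p) (r *: (tagged p : F (tag p)))
         | p : {i & F i} <- s] ++ t).
  rewrite !big_cat !big_map !scaler_sumr; split; congr (_ + _);
    by apply: eq_bigr => p _; exact/esym/linearZ.
- apply: contrapT => /coind_separates[theta]; apply.
  (* The relation [s0] is evaluated at the family of the [theta \o f i], which shows that [theta]
     vanishes on the candidate value. *)
  have := congr1 (fun u => subm_incl dsum_submod u (fun i => theta \o f i)) s0.
  rewrite linear_sum linear0 fct_sumE /= => E.
  by rewrite linear_sum.
- exists h => i a; apply: hP; exists [:: existT (fun i => F i) i a].
  by rewrite !big_seq1.
Qed.

Lemma dsum_is_coproduct : is_coproduct dsum_in.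
Proof.
move=> B f; have [h hP] := dsum_univ f; exists h; split=> // h' hP'.
by apply: dsum_ext => i a; rewrite hP hP'.
Qed.

End DirectSums.

Section FreeCover.
Variable R : pzRingType.

Definition freemod (K : Type) : lmodType R := dsum (fun _ : K => R^o).

Definition freemod_gen (K : Type) (k : K) : freemod K :=
  dsum_in (fun _ : K => R^o) k 1.

Lemma scale_linear (A : lmodType R) (a : A) : linear (fun r : R^o => (r : R) *: a).
Proof. by move=> r x y; rewrite scalerDl scalerA. Qed.

Lemma freemod_univ (K : Type) (A : lmodType R) (f : K -> A) :
  exists h : {linear freemod K -> A}, forall k, h (freemod_gen k) = f k.
Proof.
have [h hP] := dsum_univ (fun k : K => mkLin (scale_linear (f k))).
by exists h => k; rewrite hP /= scale1r.
Qed.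

Lemma freemod_ext (K : Type) (A : lmodType R) (h h' : {linear freemod K -> A}) :
  (forall k, h (freemod_gen k) = h' (freemod_gen k)) -> h =1 h'.
Proof.
move=> hh; apply: dsum_ext => k r.
have -> : dsum_in (fun _ : K => R^o) k r = (r : R) *: freemod_gen k.
  by rewrite -linearZ /=; congr (dsum_in _ _ _); exact/esym/mulr1.
by rewrite !linearZ hh.
Qed.

Lemma freemod_projective K : projective (freemod K).
Proof.
move=> A B g f sg; have [c cP] := choice (fun k => sg (f (freemod_gen k))).
have [h hP] := freemod_univ c; exists h.
by apply: (@freemod_ext K B (g \o h)) => k /=; rewrite hP cP.
Qed.

End FreeCover.

(** N embeds into the product of copies of [coind R] over all homomorphisms from N to [coind R]. *)
Lemma inj_embedding (R : pzRingType) (N : lmodType R) :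
  exists (E : lmodType R) (i : {linear N -> E}), injective i /\
    forall (A B : lmodType R) (j : {linear A -> B}) (f : {linear A -> E}),
      injective j -> exists g : {linear B -> E}, forall a, g (j a) = f a.
Proof.
pose E : lmodType R := dprod (fun _ : {linear N -> coind R} => coind R).
have [i [iP _]] := dprod_is_product (fun c : {linear N -> coind R} => c).
exists E, i; split.
  apply: linear_ker_inj => x ix; apply: contrapT => /coind_separates[c]; apply.
  by rewrite -iP ix linear0.
move=> A B j f inj_j.
have /choice[g gP] : forall c, exists g : {linear B -> coind R},
    forall a, g (j a) = dprod_proj _ c (f a).
  by move=> c; exact: (coind_extend (dprod_proj _ c \o f : {linear A -> coind R})).
have [h [hP _]] := dprod_is_product g; exists h => a.
apply: functional_extensionality_dep => c.
exact: etrans (hP c (j a)) (gP c a).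
Qed.

(** * Character modules and duality pairs *)

Section CharMap.
Variables (R : pzRingType) (A B : lmodType R) (f : {linear A -> B}).

Lemma char_map_linear :
  linear (fun psi : char_module B => char_fun psi \o f : char_module A).
Proof. by move=> a x y; apply: char_ext => b /=; rewrite linearZ. Qed.

Definition char_map : {linear char_module B -> char_module A} :=
  mkLin char_map_linear.

Lemma char_mapE psi x : char_fun (char_map psi) x = char_fun psi (f x).
Proof. by []. Qed.

End CharMap.

(** Left exactness of the character functor. *)
Lemma char_factor (R : pzRingType) (A B S : lmodType R) (f : {linear A -> S})
    (g : {linear S -> B}) (phi : char_module S) :
  short_exact f g -> char_map f phi = 0 ->
  exists psi : char_module B, char_map g psi = phi.
Proof.
case=> _ ex_fg sg phif; have kphi x : g x = 0 -> char_fun phi x = 0.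
  move=> /ex_fg[a <-].
  by rewrite -char_mapE phif.
have [h hP] := choice (fun y => sg y).
have phih x : char_fun phi (h (g x)) = char_fun phi x.
  apply/eqP; rewrite -subr_eq0 -(raddfB (char_fun phi)); apply/eqP/kphi.
  by rewrite linearB hP subrr.
have hB : zmod_morphism (fun y => char_fun phi (h y)).
  by move=> y z; rewrite -[RHS](raddfB (char_fun phi)) -[RHS]phih linearB !hP.
by exists (mkAdd hB); apply: char_ext => x; exact: phih.
Qed.

Section PairCoproduct.
Variables (R : pzRingType) (A B : lmodType R).

(** Indexing by [bool] gives the binary sum the form required by [closed_under_finite_sums]. *)
Definition pair_family (b : bool) : lmodType R := if b then A else B.

Lemma pair_inl_linear : linear (fun a : A => (a, 0) : (A * B)%type).
Proof. by move=> r a b; congr (_, _); rewrite /= scaler0 addr0. Qed.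

Lemma pair_inr_linear : linear (fun b : B => (0, b) : (A * B)%type).
Proof. by move=> r a b; congr (_, _); rewrite /= scaler0 addr0. Qed.

Definition pair_in (b : bool) : {linear pair_family b -> (A * B)%type} :=
  match b with true => mkLin pair_inl_linear | false => mkLin pair_inr_linear end.

Lemma pair_is_coproduct : is_coproduct pair_in.
Proof.
move=> Z f; have hL : linear (fun p : (A * B)%type => f true p.1 + f false p.2).
  by move=> a p q; rewrite /= !linearP scalerDr addrACA.
exists (mkLin hL); split=> [[] x /=|h' hP [a b] /=].
- by rewrite linear0 addr0.
- by rewrite linear0 add0r.
- rewrite -(hP true) -(hP false) -linearD; congr (h' _).
  by congr (_, _); rewrite /= ?addr0 ?add0r.
Qed.

Lemma pair_swap_iso : isomorphic (B * A)%type (A * B)%type.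
Proof.
have swL : linear (fun p : (B * A)%type => (p.2, p.1) : (A * B)%type) by [].
by exists (mkLin swL); exists (fun p => (p.2, p.1)) => [] [].
Qed.

End PairCoproduct.

Lemma isomorphic_trans (R : pzRingType) (A B D : lmodType R) :
  isomorphic A B -> isomorphic B D -> isomorphic A D.
Proof. by move=> [f bf] [g bg]; exists (g \o f); exact: bij_comp. Qed.

(* S^+ is isomorphic to A^+ x B^+ *)
Lemma char_retraction_closed (R : pzRingType) (M : lmodType R -> Prop)
    (C : lmodType R^c -> Prop) (A B S : lmodType R)
    (f : {linear A -> S}) (g : {linear S -> B})
    (r : {linear char_module S -> char_module B}) :
  duality_pair M C -> short_exact f g -> (forall psi, r (char_map g psi) = psi) ->
  (M S <-> M A /\ M B).
Proof.
move=> [_ isoC MC sumC fsumC] ex rP.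
have [inj_f ex_fg sg] := ex.
have isoS : isomorphic (char_module S)
    (char_module A * char_module B : lmodType R^c)%type.
  have PL : linear (fun phi => (char_map f phi, r phi)
      : (char_module A * char_module B)%type).
    by move=> a x y; rewrite !linearP.
  exists (mkLin PL); apply: bijective_inj_surj.
    apply: linear_ker_inj => phi E.
    have phif : char_map f phi = 0 := congr1 fst E.
    have rphi : r phi = 0 := congr1 snd E.
    have [psi psiE] := char_factor ex phif.
    by rewrite -psiE -[psi]rP psiE rphi linear0.
  move=> [alpha beta].
  (* Extend [alpha] to S; a correction by the image of [r phi - beta] under [char_map g] vanishes on
     A and makes the second component [beta]. *)
  have [phi phiE] := @char_extend A S f (char_fun alpha) inj_f.
  exists ((phi : char_module S) - char_map g (r phi - beta)).
  congr (_, _); last by rewrite /= linearB rP opprB addrC subrK.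
  apply: char_ext => a; rewrite /= phiE.
  have -> : g (f a) = 0 by apply/ex_fg; exists a.
  by rewrite !(raddf0 (char_fun _)) !subr0.
rewrite !MC; split=> [CS|[CA CB]].
  split.
    by apply: (sumC _ (char_module B) _ _ CS); exact: isomorphic_sym.
  apply: (sumC _ (char_module A) _ _ CS).
  exact: isomorphic_trans (pair_swap_iso _ _) (isomorphic_sym isoS).
apply: isoC (isomorphic_sym isoS) _.
apply: (fsumC _ _ _ (@pair_in _ _ _)).
  exact: pair_is_coproduct.
by case.
Qed.

(** * Existence of tensor products, and splitting of the dual of a pure sequence *)

Section TensorProduct.
Variables (R : pzRingType) (X : lmodType R^c) (M : lmodType R).

Record bal_char := BalChar {
  bal_fun :> X -> M -> QmodZ;
  bal_funP : balanced bal_fun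
}.

(* X (x) M is the group of functions on the balanced maps X x M -> Q/Z         *)
(* generated by the evaluations, as Q/Z cogenerates the abelian groups.       *)
Definition tensor_eval (p : X * M) : bal_char -> QmodZ := fun b => b p.1 p.2.

Definition tensor_pred : {pred bal_char -> QmodZ} :=
  fun u => `[< exists s, u = \sum_(p <- s) tensor_eval p >].

Lemma balancedNl (A : zmodType) (b : X -> M -> A) x m :
  balanced b -> b (- x) m = - b x m.
Proof.
case=> bDl _ _; have b0 : b 0 m = 0.
  by apply: (addrI (b 0 m)); rewrite -bDl !addr0.
by apply/eqP; rewrite -addr_eq0 -bDl addNr b0.
Qed.

Lemma tensor_pred_closed : zmod_closed tensor_pred.
Proof.
split=> [|u v /asboolP[s ->] /asboolP[t ->]]; apply/asboolP.
  by exists [::]; rewrite big_nil.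
exists (s ++ [seq (- p.1, p.2) | p <- t]).
rewrite big_cat big_map -sumrN; congr (_ + _); apply: eq_bigr => p _.
by apply/funext => b; rewrite /tensor_eval /= balancedNl //; exact: bal_funP.
Qed.

HB.instance Definition _ :=
  GRing.isZmodClosed.Build (bal_char -> QmodZ) tensor_pred tensor_pred_closed.

Record tensor := Tensor {
  tensor_val :> bal_char -> QmodZ; tensor_valP : tensor_val \in tensor_pred }.

HB.instance Definition _ := [isSub for tensor_val].
HB.instance Definition _ := [Choice of tensor by <:].
HB.instance Definition _ := [SubChoice_isSubZmodule of tensor by <:].

Lemma tensor_pure_subproof x m : tensor_eval (x, m) \in tensor_pred.
Proof. by apply/asboolP; exists [:: (x, m)]; rewrite big_seq1. Qed.

Definition tensor_pure x m : tensor := Tensor (tensor_pure_subproof x m).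

Lemma tensor_pure_balanced : balanced tensor_pure.
Proof.
split=> *; apply: val_inj; apply/funext => b;
  have [bDl bDr bZ] := bal_funP b; rewrite /= /tensor_eval /=.
- exact: bDl.
- exact: bDr.
- exact: bZ.
Qed.

Lemma tensor_valB : zmod_morphism (val : tensor -> bal_char -> QmodZ).
Proof. by []. Qed.

Lemma tensor_gen (u : tensor) :
  exists s, u = \sum_(p <- s) tensor_pure p.1 p.2.
Proof.
have /asboolP[s sE] := valP u; exists s; apply: val_inj; rewrite sE.
rewrite (raddf_sum (mkAdd tensor_valB)) /=.
by apply: eq_bigr => -[x m].
Qed.

Lemma balanced_comp (A B : zmodType) (b : X -> M -> A) (h : {additive A -> B}) :
  balanced b -> balanced (fun x m => h (b x m)).
Proof.
by case=> bDl bDr bZ; split=> *; rewrite ?bDl ?bDr ?raddfD ?bZ.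
Qed.

(** A balanced map induces a well-defined map: composed with a character of its target it becomes
    one of the points at which elements of [tensor] are evaluated, and characters separate
    points. *)
Lemma tensor_is_tensor : is_tensor tensor_pure.
Proof.
split=> [|A b bP]; first exact: tensor_pure_balanced.
pose G (u : tensor) y := exists s,
  u = \sum_(p <- s) tensor_pure p.1 p.2 /\ y = \sum_(p <- s) b p.1 p.2.
have /choice[h hP] : forall u, exists y, G u y.
  move=> u; have [s sE] := tensor_gen u.
  by exists (\sum_(p <- s) b p.1 p.2), s.
have GB u v y z : G u y -> G v z -> G (u - v) (y - z).
  move=> [s [-> ->]] [t [-> ->]]; exists (s ++ [seq (- p.1, p.2) | p <- t]).
  rewrite !big_cat !big_map -!sumrN; split; congr (_ + _);
    apply: eq_bigr => p _; rewrite balancedNl //.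
  exact: tensor_pure_balanced.
have G0 y : G 0 y -> y = 0.
  case=> s [s0 ->]; apply: contrapT => /QmodZ_separates[chi]; apply.
  have := congr1 (fun u : tensor => val u (BalChar (balanced_comp chi bP))) s0.
  rewrite (raddf_sum (mkAdd tensor_valB)) /= fct_sumE raddf_sum => E.
  exact: esym E.
have Gu u y z : G u y -> G u z -> y = z.
  move=> Gy Gz; apply/eqP; rewrite -subr_eq0; apply/eqP/G0.
  by rewrite -(subrr u); exact: GB.
have hB : zmod_morphism h.
  by move=> u v; apply: (Gu (u - v)) => //; exact: GB.
exists (mkAdd hB); split=> [x m|h' hP' u].
  by apply: (Gu (tensor_pure x m)) => //; exists [:: (x, m)]; rewrite !big_seq1.
apply: (Gu u) => //; have [s sE] := tensor_gen u; exists s; split=> //.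
by rewrite sE raddf_sum; apply: eq_bigr => p _.
Qed.

End TensorProduct.

(** Tensoring with A^+ keeps A -> S injective, so the evaluation of A^+ (x) A in Q/Z extends to A^+
    (x) S. By adjunction the extension is a map A^+ -> S^+, the section. *)
Lemma pure_exact_char_section (R : pzRingType) (A B S : lmodType R)
    (f : {linear A -> S}) (g : {linear S -> B}) :
  pure_exact f g ->
  exists s : {linear char_module A -> char_module S},
    forall phi, char_map f (s phi) = phi.
Proof.
move=> [_ /(_ (char_module A) _ _ _ _ _ _ (tensor_is_tensor _ _)
  (tensor_is_tensor _ _) (tensor_is_tensor _ _))] pure.
have tb (N N' : lmodType R) (k : {linear N -> N'}) :
    balanced (fun x m => tensor_pure (X := char_module A) x (k m)).
  case: (@tensor_pure_balanced R (char_module A) N') => tDl tDr tZ.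
  split=> [x y m|x m n|x r m]; rewrite ?linearD ?linearZ /=.
  - exact: tDl.
  - exact: tDr.
  - exact: tZ.
have [F [FP _]] := (tensor_is_tensor (char_module A) A).2 _ _ (tb _ _ f).
have [G [GP _]] := (tensor_is_tensor (char_module A) S).2 _ _ (tb _ _ g).
have [inj_F _ _] := pure F G FP GP.
have evb : balanced (fun (phi : char_module A) a => char_fun phi a).
  split=> //= *; exact: raddfD.
have [ev [evP _]] := (tensor_is_tensor (char_module A) A).2 _ _ evb.
have [e eP] := char_extend ev inj_F.
have [tDl tDr tZ] := @tensor_pure_balanced R (char_module A) S.
have sB phi : zmod_morphism (fun x => e (tensor_pure phi x)).
  move=> x y; rewrite -raddfB; congr (e _); apply/eqP.
  by rewrite eq_sym subr_eq -tDr subrK.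
have sL : linear (fun phi => mkAdd (sB phi) : char_module S).
  move=> r phi psi; apply: char_ext => x /=.
  by rewrite tDl raddfD tZ.
exists (mkLin sL) => phi; apply: char_ext => a /=.
by rewrite -FP eP evP.
Qed.

(** The splitting lemma: the identity minus [s] after [char_map f] takes values in the image of the
    injective map [char_map g]. *)
Lemma char_section_retraction (R : pzRingType) (A B S : lmodType R)
    (f : {linear A -> S}) (g : {linear S -> B})
    (s : {linear char_module A -> char_module S}) :
  short_exact f g -> (forall phi, char_map f (s phi) = phi) ->
  exists r : {linear char_module S -> char_module B},
    forall psi, r (char_map g psi) = psi.
Proof.
move=> ex sP; have [inj_f ex_fg sg] := ex.
have inj_g : injective (char_map g).
  move=> psi psi' E; apply: char_ext => y; have [x <-] := sg y.
  by rewrite -!char_mapE E.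
have kL : linear (fun phi => phi - s (char_map f phi)).
  by move=> a x y; rewrite (linearP (char_map f)) (linearP s) opprD addrACA scalerBr.
have [|r rP] := factor_inj (f := mkLin kL) inj_g.
  move=> phi; apply: (char_factor ex).
  by rewrite -[mkLin kL phi]/(phi - s (char_map f phi)) linearB sP subrr.
exists r => psi; apply: inj_g; rewrite rP.
rewrite -[mkLin kL _]/(char_map g psi - s (char_map f (char_map g psi))).
suff -> : char_map f (char_map g psi) = 0 by rewrite linear0 subr0.
apply: char_ext => a; rewrite !char_mapE.
have -> : g (f a) = 0 by apply/ex_fg; exists a.
exact: raddf0.
Qed.

Lemma duality_pair_pure_closed (R : pzRingType) (M : lmodType R -> Prop)
    (C : lmodType R^c -> Prop) : duality_pair M C -> pure_closed M.
Proof.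
move=> MC A B S f g pure; have [s sP] := pure_exact_char_section pure.
have [ex _] := pure; have [r rP] := char_section_retraction ex sP.
exact: char_retraction_closed MC ex rP.
Qed.

(** * Purity *)

(* Finitely many relations in B lift to S; this is purity of the kernel of g.  *)
Definition pure_epi (R : pzRingType) (S B : lmodType R) (g : {linear S -> B}) :=
  forall L : seq (R * B * B), exists h : B -> S, (forall b, g (h b) = b) /\
    forall r x y, (r, x, y) \in L -> h (r *: x + y) = r *: h x + h y.

(** Finite lists are directed by inclusion, so taking eventual values is a homomorphism on the
    eventually constant functions. Its extension acts as a limit along an ultrafilter would. *)
Lemma eventual_value (T : eqType) :
  exists lim : {additive (seq T -> QmodZ) -> QmodZ}, forall F c (L0 : seq T),
    (forall L : seq T, {subset L0 <= L} -> F L = c) -> lim F = c.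
Proof.
pose G : set ((seq T -> QmodZ) * QmodZ) := fun p =>
  exists L0 : seq T, forall L : seq T, {subset L0 <= L} -> p.1 L = p.2.
have HG : fun_subgroup G.
  split.
  - by exists [::].
  - move=> F c F' c' [L0 /= FL] [L0' /= FL']; exists (L0 ++ L0') => L sL.
    change (F L - F' L = c - c').
    by rewrite FL ?FL' // => x xL; apply: sL; rewrite mem_cat xL ?orbT.
  - by move=> c [L0 /= /(_ L0)<-].
have [lim limP] := QmodZ_extension HG.
by exists lim => F c L0 Fc; apply: limP; exists L0.
Qed.

(* A character phi of S is sent to b |-> lim_L phi(h_L b), where h_L is a       *)
(* section of g respecting the finite set L of relations and lim extends the  *)
(* evaluation of eventually constant functions; Q/Z is injective.             *)
Lemma pure_epi_char_retraction (R : pzRingType) (S B : lmodType R)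
    (g : {linear S -> B}) : pure_epi g ->
  exists r : {linear char_module S -> char_module B},
    forall psi, r (char_map g psi) = psi.
Proof.
move=> /choice[h hP]; have [lim limP] := eventual_value (R * B * B)%type.
have hg L b : g (h L b) = b by have [] := hP L.
have hL L r x y : (r, x, y) \in L -> h L (r *: x + y) = r *: h L x + h L y.
  by have [_] := hP L; exact.
pose val phi b L : QmodZ := char_fun phi (h L b).
have hD L x y : (1, x, y) \in L -> h L (x + y) = h L x + h L y.
  by move=> /hL; rewrite !scale1r.
have h0 L : (1, 0, 0) \in L -> h L 0 = 0.
  by move=> /hD; rewrite addr0 -[LHS]addr0 => /addrI.
have lim_eq F F' (L0 : seq (R * B * B)) :
    (forall L : seq (R * B * B), {subset L0 <= L} -> F L = F' L) ->
    lim F = lim F'.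
  move=> FF; apply/eqP; rewrite -subr_eq0 -raddfB; apply/eqP/(limP _ _ L0) => L sL.
  change (F L - F' L = 0).
  by rewrite FF // subrr.
have rD phi x y : lim (val phi (x + y)) = lim (val phi x) + lim (val phi y).
  rewrite -raddfD; apply: (lim_eq _ _ [:: (1, x, y)]) => L sL.
  by rewrite /val hD ?raddfD // sL ?mem_head.
have rB phi : zmod_morphism (fun b => lim (val phi b)).
  move=> x y; apply/eqP; rewrite eq_sym subr_eq -rD; apply/eqP.
  by congr (lim (val _ _)); rewrite subrK.
have rL : linear (fun phi => mkAdd (rB phi) : char_module B).
  move=> a phi psi; apply: char_ext => b /=.
  (* The relation [(1, 0, 0)] forces [h L 0 = 0]; then [(a, b, 0)] says that [h L] commutes with [a]
     at [b]. *)
  rewrite -raddfD; apply: (lim_eq _ _ [:: (a, b, 0); (1, 0, 0)]) => L sL.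
  change (val (a *: phi + psi) b L = val phi ((a : R) *: b) L + val psi b L).
  congr (_ + _); rewrite /val /=; congr (char_fun phi _).
  rewrite -[in RHS](addr0 ((a : R) *: b)) hL; last by rewrite sL ?mem_head.
  rewrite h0 ?addr0 //; apply: sL.
  by rewrite in_cons mem_seq1 eqxx orbT.
exists (mkLin rL) => psi; apply: char_ext => b /=.
by apply: (limP _ _ [::]) => L _; rewrite /val char_mapE hg.
Qed.

(** The form in which purity is used from here on, with no tensor products involved. *)
Lemma pure_epi_closed (R : pzRingType) (M : lmodType R -> Prop)
    (C : lmodType R^c -> Prop) (A B S : lmodType R)
    (f : {linear A -> S}) (g : {linear S -> B}) :
  duality_pair M C -> short_exact f g -> pure_epi g -> (M S <-> M A /\ M B).
Proof.
move=> MC ex /pure_epi_char_retraction[r rP].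
exact: char_retraction_closed MC ex rP.
Qed.

Lemma pure_epi_comp (R : pzRingType) (A B D : lmodType R)
    (f : {linear A -> B}) (g : {linear B -> D}) :
  pure_epi f -> pure_epi g -> pure_epi (g \o f).
Proof.
move=> pf pg L; have [h [gh hL]] := pg L.
have [k [fk kL]] := pf [seq (p.1.1, h p.1.2, h p.2) | p <- L].
exists (k \o h); split=> [d|r x y L_rxy] /=; first by rewrite fk gh.
rewrite hL // kL //.
by apply/mapP; exists (r, x, y).
Qed.

(** * Purity through finite linear systems *)

Section Systems.
Variable R : pzRingType.

(** The tuple (r, i, j, k) encodes the linear form r v_i + v_j - v_k. One shape suffices to express
    module operations, and auxiliary variables reduce other equations to it. *)
Definition clause (V : Type) : Type := R * V * V * V.

Definition lhs (V : Type) (S : lmodType R) (c : clause V) (v : V -> S) : S :=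
  c.1.1.1 *: v c.1.1.2 + v c.1.2 - v c.2.

Definition system : Type := seq (clause nat).

Definition clause0 : clause nat := (0, 0%N, 0%N, 0%N).

Definition sat (S : lmodType R) (sigma : system) (c v : nat -> S) : Prop :=
  forall m, (m < size sigma)%N -> lhs (nth clause0 sigma m) v = c m.

Definition pure_sub (S : lmodType R) (P : S -> Prop) : Prop :=
  forall (sigma : system) (c : nat -> S), (forall m, P (c m)) ->
    (exists v, sat sigma c v) -> exists v, (forall i, P (v i)) /\ sat sigma c v.

Variable S : lmodType R.
Implicit Types (P : S -> Prop) (c v : nat -> S).

Lemma lhsD (V : Type) (k : clause V) (v v' : V -> S) :
  lhs k (fun i => v i + v' i) = lhs k v + lhs k v'.
Proof.
by rewrite /lhs scalerDr [X in X - _]addrACA opprD [LHS]addrACA.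
Qed.

Lemma lhsN (V : Type) (k : clause V) (v : V -> S) :
  lhs k (fun i => - v i) = - lhs k v.
Proof. by rewrite /lhs !opprD scalerN. Qed.

Lemma pure_sub_submod P : pure_sub P -> (exists x, P x) ->
  P 0 /\ forall a x y, P x -> P y -> P (a *: x + y).
Proof.
move=> pureP [z Pz].
have key a x y t : P x -> P y -> P t -> P (a *: x + y - t).
  move=> Px Py Pt.
  (* In the first two equations v_0 cancels, which leaves v_1 = x and v_2 = y; the third then forces
     v_3 = a x + y - t. *)
  pose sigma : system :=
    [:: (1%R : R, 1, 0, 0)%N; (1%R : R, 2, 0, 0)%N; (a, 1, 2, 3)%N].
  have [] := pureP sigma (nth t [:: x; y]).
  - by case=> [|[|m]] //=; rewrite nth_nil.
  - exists (nth 0 [:: 0; x; y; a *: x + y - t]).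
    case=> [|[|[|m]]] //= _; rewrite /lhs /= ?scale1r ?addr0 ?subr0 //.
    by rewrite opprB addrC subrK.
  - move=> v [Pv sv]; have := Pv 3%N.
    have v1 : v 1%N = x by rewrite -[RHS](sv 0%N) // /lhs /= scale1r addrK.
    have v2 : v 2%N = y by rewrite -[RHS](sv 1%N) // /lhs /= scale1r addrK.
    suff -> : v 3%N = a *: x + y - t by [].
    have := sv 2%N isT; rewrite /lhs /= v1 v2 => <-.
    by rewrite opprB addrC subrK.
have P0 : P 0 by have := key 0 z z z Pz Pz Pz; rewrite scale0r add0r subrr.
by split=> // a x y Px Py; have := key a x y 0 Px Py P0; rewrite subr0.
Qed.

(** The defects of a set-theoretic section [s] on the relations of [L] lie in the kernel P. They
    form a system solved by [s] in S, hence by some [q] in P, and [s - q] respects [L]. *)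
Lemma pure_sub_epi (B : lmodType R) (g : {linear S -> B}) P :
  surjective g -> (forall x, g x = 0 <-> P x) -> pure_sub P -> pure_epi g.
Proof.
move=> /choice[s sP] kerP pureP L.
pose E := flatten [seq [:: p.1.2; p.2; p.1.1 *: p.1.2 + p.2] | p <- L].
have EL r x y : (r, x, y) \in L ->
    [/\ x \in E, y \in E & r *: x + y \in E].
  move=> Lp; have Ep : [:: x; y; r *: x + y] \in
      [seq [:: p.1.2; p.2; p.1.1 *: p.1.2 + p.2] | p <- L].
    by apply/mapP; exists (r, x, y).
  by split; apply/flattenP; exists [:: x; y; r *: x + y] => //;
    rewrite !in_cons eqxx ?orbT.
pose sigma : system := [seq (p.1.1, index p.1.2 E, index p.2 E,
  index (p.1.1 *: p.1.2 + p.2) E) | p <- L].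
pose c m : S := lhs (nth clause0 sigma m) (fun i => s (nth 0 E i)).
pose c' m : S := if (m < size sigma)%N then c m else 0.
have [] := pureP sigma c'.
- move=> m; rewrite /c'; case: ifP => [lt_m|_]; apply/kerP; last exact: linear0.
  rewrite size_map in lt_m; rewrite /c (nth_map (0, 0, 0)) //.
  have := mem_nth (0, 0, 0) lt_m; case: (nth _ L m) => -[r x] y /EL[xE yE zE].
  by rewrite /lhs /= !nth_index // linearB linearP !sP subrr.
- by exists (fun i => s (nth 0 E i)) => m lt_m; rewrite /c' lt_m.
(* Outside [E] the index is the size of [E]; the value of [q] there is still in P, so the map
   remains a section. *)
move=> q [Pq sq]; exists (fun b => s b - q (index b E)); split=> [b|r x y Lp].
  by rewrite linearB sP (kerP _).2 ?subr0.
have [xE yE zE] := EL _ _ _ Lp.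
have lt_m : (index (r, x, y) L < size L)%N by rewrite index_mem.
have := sq (index (r, x, y) L); rewrite /c' size_map lt_m => /(_ isT).
rewrite /c (nth_map (0, 0, 0)) // nth_index // /lhs /= !nth_index // => E0.
rewrite scalerBr addrACA -opprD -[in RHS](subrK (s (r *: x + y)) (_ + s y)) -E0.
by rewrite [RHS]addrAC [X in X - _ + _]addrC addrK addrC.
Qed.

End Systems.

(** * Hulls and preenvelopes *)

(** A substitute for cardinal bounds: the closure of a set of generators under operations is the
    image of a type of terms that does not mention the ambient module. *)
Inductive term (G O Ar : Type) : Type :=
  | TGen of G
  | TOp of O & (Ar -> term G O Ar).

Section Hull.
Variables (G O Ar S : Type) (g : G -> S) (op : O -> (Ar -> S) -> S).

Fixpoint eval (t : term G O Ar) : S :=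
  match t with
  | TGen x => g x
  | TOp o ts => op o (fun a => eval (ts a))
  end.

Definition hull (x : S) : Prop := exists t, eval t = x.

Lemma hull_gen x : hull (g x).
Proof. by exists (TGen O Ar x). Qed.

Lemma hull_op o c : (forall a, hull (c a)) -> hull (op o c).
Proof.
move=> /choice[ts tsP]; exists (TOp o ts) => /=; congr (op o _).
exact/funext.
Qed.

End Hull.

Section Solutions.
Variables (R : pzRingType) (S : lmodType R).

Definition some_solution (V : Type) (P : (V -> S) -> Prop) : V -> S :=
  if pselect (exists v, P v) is left ex then projT1 (cid ex) else fun=> 0.

Lemma some_solutionP (V : Type) (P : (V -> S) -> Prop) :
  (exists v, P v) -> P (some_solution P).
Proof. by rewrite /some_solution; case: pselect => // ex _; case: cid. Qed.

Definition sol (sigma : system R) (c : nat -> S) : nat -> S :=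
  some_solution (sat sigma c).

Lemma pure_sub_sol (P : S -> Prop) :
  (forall sigma c i, (forall m, P (c m)) -> P (sol sigma c i)) -> pure_sub P.
Proof.
move=> Psol sigma c Pc ex; exists (sol sigma c); split=> [i|]; first exact: Psol.
exact: some_solutionP.
Qed.

Lemma pure_submod (P : S -> Prop) : pure_sub P -> (exists x, P x) ->
  exists W : submod S, submod_set W = P.
Proof. by move=> pP /(pure_sub_submod pP)[P0 PP]; exists (Submod P0 PP). Qed.

Lemma pure_submod_epi (W : submod S) : pure_sub W -> pure_epi (quotm_proj W).
Proof.
by apply: pure_sub_epi; [exact: quotm_proj_surj|exact: quotm_proj_eq0].
Qed.

End Solutions.

(** Up to isomorphism, the modules that are images of [K] are thus indexed by the submodules of a
    single free module, so that products and sums over all of them can be formed. *)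
Lemma quotient_of_free (R : pzRingType) (K : Type) (A : lmodType R) (e : K -> A) :
  surjective e -> exists W : submod (freemod R K), isomorphic (quotm W) A.
Proof.
move=> se; have [h hP] := freemod_univ e; exists (ker_submod h).
have [|j jP] := factor_surj (f := h) (@quotm_proj_surj _ _ (ker_submod h)).
  by move=> x /quotm_proj_eq0.
exists j; apply: bijective_inj_surj.
  apply: linear_ker_inj => q; have [x <-] := quotm_proj_surj q.
  by rewrite jP => hx; apply/quotm_proj_eq0.
move=> a; have [k <-] := se a.
by exists (quotm_proj _ (freemod_gen R k)); rewrite jP hP.
Qed.

(** A solution set argument. Closing the image of N in A under chosen solutions of finite systems
    gives a pure submodule [W], in M and bounded by [K]. So a map from N to A factors through one
    component of the product over [I]. *)
Lemma duality_pair_preenveloping (R : pzRingType) (M : lmodType R -> Prop)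
    (C : lmodType R^c -> Prop) :
  duality_pair M C -> closed_under_products M -> preenveloping M.
Proof.
move=> MC prodM N; have [isoM _ _ _ _] := MC.
pose K := term N (system R * nat) nat.
pose I := {p : {W : submod (freemod R K) & {linear N -> quotm W}} |
  M (quotm (tag p))}.
pose F (i : I) : lmodType R := quotm (tag (sval i)).
have [phi [phiP _]] :=
  dprod_is_product (fun i : I => tagged (sval i) : {linear N -> F i}).
exists (dprod F), phi; split.
  by apply: prodM (@dprod_is_product R I F) _ => -[].
move=> A MA psi.
pose op (o : system R * nat) (c : nat -> A) : A := sol o.1 c o.2.
pose H := hull psi op.
have pH : pure_sub H.
  by apply: pure_sub_sol => sigma c i; exact: (@hull_op _ _ _ _ psi op (sigma, i)).
have [W WH] := pure_submod pH (ex_intro _ _ (hull_gen psi op 0)).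
have MW : M (subm W).
  have pW : pure_epi (quotm_proj W) by apply: pure_submod_epi; rewrite WH.
  by have [/(_ MA)[]] := pure_epi_closed MC (subm_quotm_exact W) pW.
have [|psi' psi'P] := factor_inj (f := psi) (@subm_incl_inj _ _ W).
  by move=> x; apply: subm_incl_surj; rewrite WH; exact: hull_gen.
have /choice[e eP] : forall t : K, exists w : subm W, subm_incl W w = eval psi op t.
  by move=> t; apply: subm_incl_surj; rewrite WH; exists t.
have se : surjective e.
  move=> w; have := subm_inclP w; rewrite WH => -[t tE]; exists t.
  by apply: (@subm_incl_inj _ _ W); rewrite eP.
have [U isoU] := quotient_of_free se; have [j [j' jK j'K]] := isoU.
have [k kP] : exists k : {linear subm W -> quotm U}, forall x, j (k x) = x.
  have [|k kP] := factor_inj (f := idfun : {linear subm W -> subm W}) (can_inj jK).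
    by move=> x; exists (j' x).
  by exists k.
have MU : M (quotm U) by apply: isoM (isomorphic_sym isoU) MW.
pose i : I := exist (fun p => M (quotm (tag p)))
  (existT (fun U : submod (freemod R K) => {linear N -> quotm U}) U (k \o psi')) MU.
exists (subm_incl W \o (j \o dprod_proj F i)) => x.
have E : dprod_proj F i (phi x) = k (psi' x) := phiP i x.
by rewrite -[RHS]/(subm_incl W (j (dprod_proj F i (phi x)))) E kP psi'P.
Qed.

(** * Bounding pure quotients, and precovers *)

Section Bound.
Variables (R : pzRingType) (S N : lmodType R) (f : {linear S -> N}).

(** Names for the elements obtained from one generator by [local_op]; the boolean chooses between a
    solution and a correction, the number selects a coordinate. *)
Definition local_term : Type := term unit (system R * nat * bool) nat.

(* Infinite systems in variables indexed by [local_term]: homogeneous clauses, *)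
(* variables with prescribed values, and the images of all variables in N.    *)
Definition shape : Type :=
  (clause R local_term -> Prop) * (local_term -> Prop) * (local_term -> N).

Definition bound_term : Type := term unit (shape * local_term) local_term.

Definition shape_sat (o : shape) (c : local_term -> S) (v : local_term -> S) :=
  [/\ forall k, o.1.1 k -> lhs k v = 0, forall t, o.1.2 t -> v t = c t
    & forall t, f (v t) = o.2 t].

Definition bound_op (o : shape * local_term) (c : local_term -> S) : S :=
  some_solution (shape_sat o.1 c) o.2.

Definition bound_eval : bound_term -> S := eval (fun=> 0) bound_op.

Definition bound_hull : S -> Prop := hull (fun _ : unit => 0) bound_op.

Let H := bound_hull.

(** Elements of the hull which, subtracted from the constants [c], make the system solvable. *)
Definition correction (sigma : system R) (c : nat -> S) : nat -> S :=
  some_solution (fun a => (forall m, H (a m)) /\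
    exists v, sat sigma (fun m => c m - a m) v).

Definition local_op (o : system R * nat * bool) (c : nat -> S) : S :=
  if o.2 then sol o.1.1 c o.1.2 else correction o.1.1 c o.1.2.

(* If x is outside the hull H, let B be the closure of x under solutions and   *)
(* corrections. Then B maps to H by a homomorphism theta over N which is the  *)
(* identity on the intersection of B and H, and {b - theta b} is a nonzero    *)
(* pure submodule in the kernel of f.                                         *)
Lemma bound_hull_total :
  (forall Q : S -> Prop, pure_sub Q -> (forall x, Q x -> f x = 0) ->
    forall x, Q x -> x = 0) ->
  forall x, H x.
Proof.
move=> noQ x; apply: contrapT => nHx.
have H0 : H 0 by exact: (hull_gen (fun _ : unit => 0) bound_op tt).
pose B : S -> Prop := hull (fun _ : unit => x) local_op.
have [e eP] : exists e : local_term -> S, forall b, B b -> exists t, e t = b.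
  by exists (eval (fun=> x) local_op).
have Bx : B x by exact: (hull_gen (fun _ : unit => x) local_op tt).
have Bsol sigma c i : (forall m, B (c m)) -> B (sol sigma c i).
  exact: (@hull_op _ _ _ _ (fun=> x) local_op (sigma, i, true)).
have Bcor sigma c i : (forall m, B (c m)) -> B (correction sigma c i).
  exact: (@hull_op _ _ _ _ (fun=> x) local_op (sigma, i, false)).
have [B0 BP] := pure_sub_submod (pure_sub_sol Bsol) (ex_intro _ x Bx).
have BB y z : B y -> B z -> B (y - z).
  by move=> By Bz; rewrite addrC -scaleN1r; exact: BP.
(* The shape records the relations among the elements of [B], which of them lie in [H], and their
   images in N. Since [e] realises it, so does the chosen solution [w], whose values lie in [H]. The
   default 0 in [c] keeps all constants in [H]. *)
pose o : shape := (fun k => lhs k e = 0, fun t => H (e t), fun t => f (e t)).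
pose c t := if pselect (H (e t)) then e t else 0.
pose w : local_term -> S := some_solution (shape_sat o c).
have [w_lin w_H w_f] : shape_sat o c w.
  apply: some_solutionP; exists e; split=> // t Ht.
  by rewrite /c; case: pselect.
have Hw t : H (w t).
  apply: (@hull_op _ _ _ _ (fun=> 0) bound_op (o, t)) => t'.
  by rewrite /c; case: pselect.
have [k kP] : exists k : S -> local_term, forall b, B b -> e (k b) = b.
  have /choice[k kP] : forall b, exists t, B b -> e t = b.
    move=> b; have [/eP[t tE]|nB] := pselect (B b); first by exists t.
    by exists (TGen _ _ tt).
  by exists k.
pose theta b := w (k b).
have thetaP r y z : B y -> B z -> theta (r *: y + z) = r *: theta y + theta z.
  move=> By Bz; apply/esym/eqP; rewrite -subr_eq0; apply/eqP.
  apply: (w_lin (r, k y, k z, k (r *: y + z))).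
  change (r *: e (k y) + e (k z) - e (k (r *: y + z)) = 0).
  by rewrite !kP ?subrr //; exact: BP.
have thetaB y z : B y -> B z -> theta (y - z) = theta y - theta z.
  by move=> By Bz; rewrite addrC -scaleN1r thetaP // scaleN1r addrC.
have theta_H b : B b -> H b -> theta b = b.
  move=> Bb Hb; have kb := kP b Bb.
  rewrite /theta w_H; last by rewrite -[o.1.2 _]/(H (e (k b))) kb.
  by rewrite /c kb; case: pselect.
have theta_f b : B b -> f (theta b) = f b.
    by move=> Bb; rewrite /theta w_f -[RHS](congr1 f (kP b Bb)).
have theta_lhs (j : clause R nat) v : (forall i, B (v i)) ->
    theta (lhs j v) = lhs j (fun i => theta (v i)).
  by move=> Bv; rewrite /lhs thetaB ?thetaP //; exact: BP.
pose Q y := exists2 b, B b & y = b - theta b.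
have xQ : x - theta x = 0.
  apply: (noQ Q); last by exists x.
    move=> sigma q Qq [v qv].
    have /choice[b bP] m : exists b, B b /\ q m = b - theta b.
      by have [b Bb qm] := Qq m; exists b.
    have Bb m : B (b m) by have [] := bP m.
    have qE m : q m = b m - theta (b m) by have [] := bP m.
    (* The elements [theta (b m)] are one admissible correction, with solution [v]. The chosen [d]
       lies in both [B] and [H], so [theta] fixes it. With [y] in [B] solving [b - d], the
       differences y - theta y solve b - theta b = q inside [Q]. *)
    pose d := correction sigma b.
    have [Hd exd] : (forall m, H (d m)) /\
        exists v, sat sigma (fun m => b m - d m) v.
      apply: (@some_solutionP R S nat (fun a => (forall m, H (a m)) /\
        exists v, sat sigma (fun m => b m - a m) v)).
      exists (fun m => theta (b m)); split=> [m|]; first exact: Hw.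
      by exists v => m lt_m; rewrite qv.
    have Bd m : B (d m) by exact: Bcor.
    have Bbd m : B (b m - d m) by exact: BB.
    pose y := sol sigma (fun m => b m - d m).
    have By i : B (y i) by exact: Bsol.
    have yP : sat sigma (fun m => b m - d m) y by exact: some_solutionP.
    exists (fun i => y i - theta (y i)); split=> [i|m lt_m].
      by exists (y i).
    rewrite lhsD lhsN -theta_lhs // yP // thetaB // (theta_H (d m)) // qE.
    by rewrite opprB addrA subrK.
  by move=> _ [b Bb ->]; rewrite linearB theta_f // subrr.
by apply: nHx; move/eqP: xQ; rewrite subr_eq0 => /eqP ->; exact: Hw.
Qed.

End Bound.

(** * Maximal pure submodules of a kernel, and precovers *)

Section MaximalPure.
Variables (R : pzRingType) (A N : lmodType R) (f : {linear A -> N}).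

Definition pure_in_ker (X : set A) : Prop := exists W : submod A,
  [/\ submod_set W = X, forall x, W x -> f x = 0 & pure_epi (quotm_proj W)].

Lemma pure_epi_ker (B : lmodType R) (g : {linear A -> B}) :
  surjective g -> pure_epi g -> pure_epi (quotm_proj (ker_submod g)).
Proof.
move=> sg pg; have [|j jP] :=
  factor_surj (f := g) (@quotm_proj_surj _ _ (ker_submod g)).
  by move=> x /quotm_proj_eq0.
have inj_j : injective j.
  apply: linear_ker_inj => q; have [x <-] := quotm_proj_surj q.
  by rewrite jP => gx; apply/quotm_proj_eq0.
move=> L; have [h [gh hL]] := pg [seq (p.1.1, j p.1.2, j p.2) | p <- L].
exists (h \o j); split=> [q|r x y Lp] /=.
  by apply: inj_j; rewrite jP gh.
by rewrite linearP hL //; apply/mapP; exists (r, x, y).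
Qed.

Lemma chain_finite (T : eqType) (V : Type) (F : set (set V)) (d : T -> V)
    (X0 : set V) (s : seq T) : F X0 ->
  (forall X Y, F X -> F Y -> (X `<=` Y \/ Y `<=` X)%classic) ->
  (forall t, t \in s -> exists2 X, F X & X (d t)) ->
  exists2 X, F X & forall t, t \in s -> X (d t).
Proof.
move=> FX0 Ftot; elim: s => [|t s IH] sP; first by exists X0.
have [X FX XP] := IH (fun u us => sP u (mem_behead (s := t :: s) us)).
have [Y FY Yt] := sP t (mem_head t s).
have [XY|YX] := Ftot _ _ FX FY; [exists Y|exists X] => // u;
  rewrite in_cons => /predU1P[->|us] //; first exact/XY/XP.
- exact: YX.
- exact: XP.
Qed.

(** By Zorn's lemma. The union of a chain is pure: the finitely many defects of a set-theoretic
    section already lie in one member of the chain, and the local section of that member can be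
    used. *)
Lemma maximal_pure_in_ker : exists W : submod A,
  [/\ forall x, W x -> f x = 0, pure_epi (quotm_proj W)
    & forall W' : submod A, (forall x, W x -> W' x) ->
        (forall x, W' x -> f x = 0) -> pure_epi (quotm_proj W') ->
      forall x, W' x -> W x].
Proof.
have [||X [[W [WX Wf Wp]] _ maxX]] := @Zorn_above A pure_in_ker (fun x => x = 0).
- have P0 a x y : x = 0 -> y = 0 -> a *: x + y = 0 :> A.
    by move=> -> ->; rewrite scaler0 addr0.
  exists (Submod (erefl 0) P0); split=> // [x /= ->|L]; first exact: linear0.
  have /choice[s sP] := @quotm_proj_surj _ _ (Submod (erefl 0) P0).
  exists s; split=> // r x y _; apply/eqP; rewrite -subr_eq0; apply/eqP.
  apply/(quotm_proj_eq0 (Submod (erefl 0) P0)).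
  by rewrite linearB linearP !sP subrr.
- move=> F [X0 FX0] FP Ftot.
  have F0 X : F X -> X 0 by move=> /FP[W [<- _ _]]; exact: submod_set0.
  pose U (x : A) : Prop := exists2 X, F X & X x.
  have U0 : U 0 by exists X0 => //; exact: F0.
  have UP a x y : U x -> U y -> U (a *: x + y).
    move=> [X FX Xx] [Y FY Yy].
    have [XY|YX] := Ftot _ _ FX FY; [exists Y|exists X] => //.
      have [W [WY _ _]] := FP _ FY; rewrite -WY in Yy XY *.
      by apply: submod_setP => //; exact: XY.
    have [W [WX _ _]] := FP _ FX; rewrite -WX in Xx YX *.
    by apply: submod_setP => //; exact: YX.
  exists (Submod U0 UP); split=> // [x [X FX Xx]|L].
    by have [W [WX Wf _]] := FP _ FX; apply: Wf; rewrite WX.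
  have /choice[s sP] := @quotm_proj_surj _ _ (Submod U0 UP).
  pose d (p : R * quotm (Submod U0 UP) * quotm (Submod U0 UP)) : A :=
    p.1.1 *: s p.1.2 + s p.2 - s (p.1.1 *: p.1.2 + p.2).
  have [|X FX XL] := @chain_finite _ A F d X0 L FX0 Ftot.
    move=> p _; apply/(quotm_proj_eq0 (Submod U0 UP)).
    by rewrite linearB linearP !sP subrr.
  have [W [WX Wf Wp]] := FP _ FX.
  have [h [hs hL]] :=
    Wp [seq (p.1.1, quotm_proj W (s p.1.2), quotm_proj W (s p.2)) | p <- L].
  exists (fun q => h (quotm_proj W (s q))); split=> [q|r x y Lp].
    rewrite -[RHS]sP; apply/eqP; rewrite -subr_eq0 -linearB; apply/eqP.
    apply/quotm_proj_eq0; exists X => //; rewrite -WX.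
    by apply/quotm_proj_eq0; rewrite linearB hs subrr.
  rewrite -hL; last by apply/mapP; exists (r, x, y).
  congr h; rewrite -linearP; apply/esym/eqP; rewrite -subr_eq0 -linearB; apply/eqP.
  by apply/quotm_proj_eq0; rewrite WX; exact: (XL _ Lp).
exists W; split=> // W' WW' Wf' Wp' x Wx'; rewrite WX.
apply: (maxX (submod_set W')) => //; first by exists W'.
by rewrite -WX.
Qed.

End MaximalPure.

(* [bound_term N] does not depend on A: f factors through a pure quotient of    *)
(* bounded size.                                                              *)
Lemma factor_bounded (R : pzRingType) (A N : lmodType R) (f : {linear A -> N}) :
  exists (W : submod A) (e : bound_term N -> quotm W) (g : {linear quotm W -> N}),
  [/\ pure_epi (quotm_proj W), surjective e & forall x, g (quotm_proj W x) = f x].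
Proof.
have [W [Wf Wp maxW]] := maximal_pure_in_ker f.
have [|g gP] := factor_surj (f := f) (@quotm_proj_surj _ _ W).
  by move=> x /quotm_proj_eq0; exact: Wf.
exists W, (bound_eval g), g; split=> //; apply: bound_hull_total => Q Qp Qg x Qx.
have [WQ WQE] := pure_submod Qp (ex_intro _ x Qx).
have pWQ : pure_epi (quotm_proj WQ) by apply: pure_submod_epi; rewrite WQE.
(* The preimage of [Q] in A is the kernel of a composite of two pure quotient maps and lies in the
   kernel of [f], so the maximality of [W] makes [Q] zero. *)
pose gQ : {linear A -> quotm WQ} := quotm_proj WQ \o quotm_proj W.
have sgQ : surjective gQ.
  move=> z; have [y <-] := quotm_proj_surj z; have [a <-] := quotm_proj_surj y.
  by exists a.
have maxQ := maxW (ker_submod gQ).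
case: (quotm_proj_surj x) Qx => a <- Qa; apply/quotm_proj_eq0; apply: maxQ.
- move=> y /quotm_proj_eq0 Wy.
  by change (quotm_proj WQ (quotm_proj W y) = 0); rewrite Wy linear0.
- by move=> y /quotm_proj_eq0; rewrite WQE => /Qg; rewrite gP.
- by apply: pure_epi_ker; [exact: sgQ|exact: pure_epi_comp].
- by change (quotm_proj WQ (quotm_proj W a) = 0); apply/quotm_proj_eq0; rewrite WQE.
Qed.

(** Dual to the preenvelopes: by [factor_bounded] every map from a module of M to N factors through
    a pure quotient that is bounded and still in M, hence through one summand. *)
Lemma duality_pair_precover (R : pzRingType) (M : lmodType R -> Prop)
    (C : lmodType R^c -> Prop) :
  duality_pair M C -> closed_under_coproducts M ->
  forall N : lmodType R, exists (A : lmodType R) (phi : {linear A -> N}),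
    is_precover M phi.
Proof.
move=> MC coprodM N; have [isoM _ _ _ _] := MC.
pose K := bound_term N.
pose I := {p : {W : submod (freemod R K) & {linear quotm W -> N}} |
  M (quotm (tag p))}.
pose F (i : I) : lmodType R := quotm (tag (sval i)).
have [phi phiP] := dsum_univ (fun i : I => tagged (sval i) : {linear F i -> N}).
exists (dsum F), phi; split.
  by apply: coprodM (@dsum_is_coproduct R I F) _ => -[].
move=> A MA psi; have [W [e [g [Wp se gP]]]] := factor_bounded psi.
have [/(_ MA)[_ MW] _] := pure_epi_closed MC (subm_quotm_exact W) Wp.
have [U isoU] := quotient_of_free se; have [j [j' jK j'K]] := isoU.
have [|k kP] := factor_inj (f := idfun : {linear quotm W -> quotm W}) (can_inj jK).
  by move=> x; exists (j' x).
have MU : M (quotm U) by apply: isoM (isomorphic_sym isoU) MW.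
pose i : I := exist (fun p => M (quotm (tag p)))
  (existT (fun U : submod (freemod R K) => {linear quotm U -> N}) U (g \o j)) MU.
exists (dsum_in F i \o (k \o quotm_proj W)) => x.
have E : phi (dsum_in F i (k (quotm_proj W x))) = g (j (k (quotm_proj W x))) :=
  phiP i _.
by rewrite -[RHS]/(phi (dsum_in F i (k (quotm_proj W x)))) E kP gP.
Qed.

(** * Directed colimits *)

Section Colimit.
Variables (R : pzRingType) (X : lmodType R) (I : Type) (le : I -> I -> Prop).
Variable u : I -> I -> {linear X -> X}.

(** All objects of the system are the same module X, which is the case for iterated endomorphisms;
    [u i j] matters only for [le i j]. *)
Record directed_system : Prop := DirectedSystem {
  dir_inhab : exists i : I, True;
  dir_refl : forall i, le i i;
  dir_trans : forall i j k, le i j -> le j k -> le i k;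
  dir_ub : forall i j, exists k, le i k /\ le j k;
  dir_id : forall i x, u i i x = x;
  dir_comp : forall i j k, le i j -> le j k -> forall x, u j k (u i j x) = u i k x
}.

(** The elementwise description of a directed colimit; the universal property follows in
    [colim_factor]. *)
Record is_colim (Z : lmodType R) (l : I -> {linear X -> Z}) : Prop := IsColim {
  colim_coh : forall i j, le i j -> forall x, l j (u i j x) = l i x;
  colim_surj : forall z, exists i x, l i x = z;
  colim_sep : forall i x, l i x = 0 -> exists j, le i j /\ u i j x = 0
}.

Hypothesis dir : directed_system.

Lemma colim_factor (Z : lmodType R) (l : I -> {linear X -> Z}) (B : lmodType R)
    (f : I -> {linear X -> B}) : is_colim l ->
  (forall i j, le i j -> forall x, f j (u i j x) = f i x) ->
  exists h : {linear Z -> B}, forall i x, h (l i x) = f i x.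
Proof.
move=> cl fcoh.
have [|a _ _ _ _ [i [x [-> ->]]] [j [y [-> ->]]]|y [i [x [lx ->]]]|h hP] :=
  @linear_of_rel R Z B (fun z y => exists i x, z = l i x /\ y = f i x).
- by move=> z; have [i [x <-]] := colim_surj cl z; exists (f i x), i, x.
- have [k [ik jk]] := dir_ub dir i j.
  exists k, (a *: u i k x + u j k y).
  by rewrite !linearP !(colim_coh cl) // !fcoh.
- have [j [ij ux]] := colim_sep cl (esym lx).
  by rewrite -(fcoh _ _ ij) ux linear0.
by exists h => i x; apply: hP; exists i, x.
Qed.

(* The colimit is a pure quotient of a direct sum of copies of X: a finite     *)
(* part of the sum retracts onto the component of an upper bound of its        *)
(* indices.                                                                   *)
Lemma colim_exists : exists (Z : lmodType R) (l : I -> {linear X -> Z}),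
  is_colim l /\ forall M C, duality_pair M C -> closed_under_coproducts M ->
    M X -> M Z.
Proof.
have [[i0 _] lerefl letrans ub uid ucomp] := dir.
pose D := dsum (fun _ : I => X); pose inj i : {linear X -> D} := dsum_in _ i.
have th_ex j : exists th : {linear D -> X},
    forall i x, th (inj i x) = if pselect (le i j) then u i j x else 0.
  pose z : {linear X -> X} := \0.
  have [h hP] := dsum_univ (fun i => if pselect (le i j) then u i j else z).
  by exists h => i x; rewrite hP; case: pselect.
have [th thP] := choice th_ex.
have thE i j x : le i j -> th j (inj i x) = u i j x.
  by move=> ij; rewrite thP; case: pselect.
(* [th j] collapses the components below [j] into X, so the colimit is the sum modulo the elements
   that all late [th j] kill. *)
pose w (c : D) := exists i, forall j, le i j -> th j c = 0.
have wP a c d : w c -> w d -> w (a *: c + d).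
  move=> [i ci] [j dj]; have [k [ik jk]] := ub i j; exists k => m km.
  by rewrite linearP ci ?dj ?scaler0 ?addr0 //; exact: letrans km.
have w0 : w 0 by exists i0 => j _; rewrite linear0.
pose W := Submod w0 wP; pose l i : {linear X -> quotm W} := quotm_proj W \o inj i.
have lE i x : l i x = quotm_proj W (inj i x) by [].
have pi_eq c d : w (c - d) -> quotm_proj W c = quotm_proj W d.
  move=> wcd; apply/eqP; rewrite -subr_eq0 -linearB; apply/eqP.
  exact/quotm_proj_eq0.
have lcoh i j : le i j -> forall x, l j (u i j x) = l i x.
  move=> ij x; rewrite !lE; apply: pi_eq; exists j => k jk.
  rewrite linearB !thE //; last exact: letrans jk.
  by rewrite ucomp // subrr.
have retr c : exists i, forall j, le i j ->
    quotm_proj W (inj j (th j c)) = quotm_proj W c.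
  have [s ->] := dsum_gen c; elim: s => [|p s [i IH]].
    by exists i0 => j _; rewrite big_nil !linear0.
  have [k [ik pk]] := ub i (tag p); exists k => j kj.
  rewrite big_cons !linearD IH; last exact: letrans kj.
  congr (_ + _); have pj : le (tag p) j by exact: letrans kj.
  have E : quotm_proj W (inj j (th j (inj (tag p) (tagged p)))) =
      quotm_proj W (inj (tag p) (tagged p)) by rewrite thE // -!lE lcoh.
  exact: E.
exists (quotm W), l; split.
  split=> // [z|i x].
    have [c <-] := quotm_proj_surj z; have [i iP] := retr c.
    by exists i, (th i c); rewrite lE iP.
  rewrite lE => /quotm_proj_eq0[j jP]; have [k [ik jk]] := ub i j.
  by exists k; split=> //; rewrite -thE // jP.
move=> M C MC coprodM MX.
have MD : M D by exact: coprodM (@dsum_is_coproduct R I (fun=> X)) (fun=> MX).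
suff pW : pure_epi (quotm_proj W).
  by have [/(_ MD)[]] := pure_epi_closed MC (subm_quotm_exact W) pW.
move=> L; have /choice[s sP] := @quotm_proj_surj _ _ W.
pose E := flatten [seq [:: p.1.2; p.2; p.1.1 *: p.1.2 + p.2] | p <- L].
pose err (p : R * quotm W * quotm W) :=
  p.1.1 *: s p.1.2 + s p.2 - s (p.1.1 *: p.1.2 + p.2).
(* At a late enough [j], [inj j] after [th j] after [s] is a section on [E], and it respects [L]
   because [th j] kills the errors of [s] there. *)
have [j [jE jL]] : exists j,
    (forall z, z \in E -> quotm_proj W (inj j (th j (s z))) = z) /\
    (forall p, p \in L -> th j (err p) = 0).
  have [jE jEP] : exists jE, forall j, le jE j -> forall z, z \in E ->
      quotm_proj W (inj j (th j (s z))) = z.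
    elim: E => [|z E [i IH]]; first by exists i0.
    have [i' i'P] := retr (s z); have [k [ik i'k]] := ub i i'.
    exists k => j kj y; rewrite in_cons => /predU1P[->|/IH]; last first.
      by apply; exact: letrans kj.
    by rewrite i'P ?sP //; exact: letrans kj.
  have [jL jLP] : exists jL, forall j, le jL j -> forall p, p \in L ->
      th j (err p) = 0.
    elim: {E jE jEP} L => [|p L [i IH]]; first by exists i0.
    have [i' i'P] : w (err p).
      apply/(quotm_proj_eq0 W).
      by rewrite linearB linearP !sP subrr.
    have [k [ik i'k]] := ub i i'.
    exists k => j kj q; rewrite in_cons => /predU1P[->|/IH]; last first.
      by apply; exact: letrans kj.
    by apply: i'P; exact: letrans kj.
  have [j [Ej Lj]] := ub jE jL; exists j; split; first exact: jEP.
  exact: jLP.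
exists (fun z => if z \in E then inj j (th j (s z)) else s z); split.
  by move=> z; case: ifP => [/jE|].
move=> r x y Lp; have Ep : [:: x; y; r *: x + y] \in
    [seq [:: p.1.2; p.2; p.1.1 *: p.1.2 + p.2] | p <- L].
  by apply/mapP; exists (r, x, y).
have inE' z : z \in [:: x; y; r *: x + y] -> z \in E.
  by move=> zE; apply/flattenP; exists [:: x; y; r *: x + y].
rewrite !inE' ?in_cons ?eqxx ?orbT //.
rewrite -!linearP; apply/esym/eqP; rewrite -subr_eq0 -!linearB.
by rewrite (jL _ Lp) linear0.
Qed.

End Colimit.

(** * Weakly terminal objects all of whose endomorphisms are bijective *)

(** Cantor's diagonal argument; it puts an end to iterations along a well-ordered power set. *)
Lemma no_powerset_injection (X : Type) (i : (X -> Prop) -> X) : ~ injective i.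
Proof.
move=> inj_i; pose D x := exists A, i A = x /\ ~ A x.
have nD : ~ D (i D).
  by move=> /[dup] DD [A [/inj_i -> nA]].
exact: (nD (ex_intro _ D (conj erefl nD))).
Qed.

Lemma strict_well_order (T : eqType) : exists lt : T -> T -> Prop,
  [/\ well_founded lt, forall x y z, lt x y -> lt y z -> lt x z
    & forall x y, [\/ lt x y, x = y | lt y x]].
Proof.
have [W Wwo] := well_ordering_principle T.
have minW (A : T -> Prop) x : A x -> exists z, A z /\ forall y, A y -> W z y.
  move=> Ax; have [|z [[Az zmin] _]] := Wwo (fun y => `[< A y >]).
    by exists x; apply/asboolP.
  by exists z; split=> [|y Ay]; [exact/asboolP|apply: zmin; exact/asboolP].
have Wtot x y : W x y \/ W y x.
  have [|z [[->|->] zmin]] := minW (fun z => z = x \/ z = y) x; first by left.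
    by left; apply: zmin; right.
  by right; apply: zmin; left.
have Wxx x : W x x by case: (Wtot x x).
have Wanti x y : W x y -> W y x -> x = y.
  move=> xy yx; have [|z [_ zu]] := Wwo (pred2 x y).
    by exists x; rewrite inE eqxx.
  have min a : a = x \/ a = y -> minimum_of W (pred2 x y) a.
    by move=> [->|->]; split; rewrite ?inE ?eqxx ?orbT // => b;
      rewrite inE => /orP[] /eqP ->.
  by rewrite -(zu x (min x _)) ?(zu y (min y _)); auto.
have Wtr x y z : W x y -> W y z -> W x z.
  move=> xy yz.
  have [|a [[->|[->|->]] amin]] := minW (fun a => a = x \/ a = y \/ a = z) x.
  - by left.
  - by apply: amin; right; right.
  - have yx : W y x by apply: amin; left.
    by rewrite (Wanti x y).
  - have zy : W z y by apply: amin; right; left.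
    by rewrite -(Wanti y z).
exists (fun x y => W x y /\ x <> y); split.
- move=> x; apply: contrapT => nx.
  have [z [nz zmin]] := minW (fun x => ~ Acc (fun x y => W x y /\ x <> y) x) x nx.
  apply: nz; constructor=> y [yz nyz]; apply: contrapT => /zmin zy.
  exact/nyz/Wanti.
- move=> x y z [xy nxy] [yz nyz]; split; first exact: Wtr yz.
  by move=> xz; apply: nxy; apply: Wanti => //; rewrite xz.
- move=> x y; have [->|/eqP nxy] := eqVneq x y; first by constructor 2.
  have [xy|yx] := Wtot x y; first by constructor 1.
  by constructor 3; split=> // E; apply: nxy.
Qed.

Lemma wf_irr (T : Type) (lt : T -> T -> Prop) (x : T) :
  well_founded lt -> ~ lt x x.
Proof. by move=> wf; elim/(well_founded_ind wf): x => x IH xx; exact: (IH x). Qed.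

Lemma pointed_well_order (T : eqType) (t0 : T) : exists (lt : T -> T -> Prop) bot,
  [/\ well_founded lt, forall x y z, lt x y -> lt y z -> lt x z,
    forall x y, [\/ lt x y, x = y | lt y x],
    forall x, x <> bot -> lt bot x & forall x, ~ lt x bot].
Proof.
have [lt [lt_wf lt_trans lt_total]] := strict_well_order T; exists lt.
have [bot bot_min] : exists bot, forall x, ~ lt x bot.
  apply: contrapT => nbot.
  suff none : forall x : T, False by exact: none t0.
  apply: (well_founded_ind lt_wf) => x IH; apply: nbot; exists x => y.
  exact: IH.
exists bot; split=> // x nx.
by have [/bot_min|//|] := lt_total x bot.
Qed.

Section Minimality.
Variables (R : pzRingType) (Obj : Type) (car : Obj -> lmodType R).
Variable hom : forall X Y, {linear car X -> car Y} -> Prop.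
Arguments hom {X Y}.

Definition weakly_terminal (T : Obj) : Prop :=
  forall X, exists f : {linear car X -> car T}, hom f.

(** Common to the modules of M over N and the extensions of modules of M by N. The cocones are asked
    to be jointly surjective, for systems of endomorphisms of one object. *)
Record concrete_category : Prop := ConcreteCategory {
  hom_id : forall X, hom (idfun : {linear car X -> car X});
  hom_comp : forall X Y Z (f : {linear car X -> car Y})
    (g : {linear car Y -> car Z}), hom f -> hom g -> hom (g \o f);
  hom_cocone : forall X (I : Type) (le : I -> I -> Prop)
      (u : I -> I -> {linear car X -> car X}),
    directed_system le u -> (forall i j, le i j -> hom (u i j)) ->
    exists Z (l : I -> {linear car X -> car Z}), [/\ forall i, hom (l i),
      forall i j, le i j -> forall x, l j (u i j x) = l i x
      & forall z, exists i x, l i x = z]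
}.

Hypothesis cat : concrete_category.

Lemma cocone_to (T X : Obj) (I : Type) (le : I -> I -> Prop)
    (u : I -> I -> {linear car X -> car X}) :
  weakly_terminal T -> directed_system le u ->
  (forall i j, le i j -> hom (u i j)) ->
  exists l : I -> {linear car X -> car T}, (forall i, hom (l i)) /\
    forall i j, le i j -> forall x, l j (u i j x) = l i x.
Proof.
move=> WT dir hu; have [Z [l [hl lcoh _]]] := hom_cocone cat dir hu.
have [f hf] := WT Z; exists (fun i => f \o l i); split=> [i|i j ij x /=].
  exact: hom_comp.
by rewrite lcoh.
Qed.

(** * Transfinite iteration of endomorphisms *)

Section Transfinite.
Variables (T : Obj) (W : eqType) (lt : W -> W -> Prop) (bot : W).
Hypothesis WT : weakly_terminal T.
Hypothesis lt_wf : well_founded lt.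
Hypothesis lt_trans : forall x y z, lt x y -> lt y z -> lt x z.
Hypothesis lt_total : forall x y, [\/ lt x y, x = y | lt y x].
Hypothesis bot_min : forall x, x <> bot -> lt bot x.
Hypothesis nlt_bot : forall x, ~ lt x bot.

Let E := {linear car T -> car T}.
Variable s : E -> E.
Hypothesis hom_s : forall w : E, hom w -> hom (s w).

Definition below_cocone (al : W) (u : W -> W -> E) (l : W -> E) : Prop :=
  (forall be, lt be al -> hom (l be)) /\
  forall be ga, lt be ga -> lt ga al -> forall x, l ga (u be ga x) = l be x.

Let idE : E := idfun.

(** Recursion on the target index: a cocone [l] to T on the system below [al] is chosen and followed
    by [s (l bot)]. The identities are defaults; [column_cocone] provides the cocone once the system
    below [al] is known to be coherent. *)
Definition column_step (al : W) (rec : forall ga, lt ga al -> W -> E) : W -> E :=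
  fun be => if be == al then idE else
    let u be ga := if pselect (lt ga al) is left H then rec ga H be else idE in
    let l := if pselect (exists l, below_cocone al u l) is left ex
             then projT1 (cid ex) else fun=> idE in
    s (l bot) \o l be.

Definition column : W -> W -> E := Fix lt_wf (fun _ => W -> E) column_step.

Let u be al := column al be.

Lemma column_id al : u al al = idE.
Proof.
rewrite /u /column Fix_eq /column_step ?eqxx // => y f g fg.
by have -> : f = g by apply: functional_extensionality_dep => z;
  apply: functional_extensionality_dep => p; exact: fg.
Qed.

Lemma column_below al l0 : below_cocone al u l0 -> exists l, below_cocone al u l /\
  forall be, lt be al -> u be al = (s (l bot) \o l be : E).
Proof.
move=> l0P.
pose u' be ga := if pselect (lt ga al) is left H then u be ga else idE.
have u'E be ga : lt ga al -> u' be ga = u be ga by rewrite /u'; case: pselect.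
have u'u l : below_cocone al u l <-> below_cocone al u' l.
  by split=> -[hl coh]; split=> // be ga bg ga_al x; have := coh _ _ bg ga_al x;
    rewrite u'E.
pose l := if pselect (exists l, below_cocone al u' l) is left ex
          then projT1 (cid ex) else fun=> idE.
exists l; split.
  rewrite u'u /l; case: pselect => [ex|[]]; first by case: cid.
  by exists l0; apply/u'u.
move=> be lt_be.
rewrite {1}/u /column Fix_eq; last first.
  move=> y f g fg; have -> // : f = g.
  by apply: functional_extensionality_dep => z;
    apply: functional_extensionality_dep => p; exact: fg.
rewrite /column_step; case: eqP => [E0|//].
by case: (wf_irr (x := al) lt_wf); rewrite -{1}E0.
Qed.

Lemma column_cocone al : al <> bot ->
  (forall be ga, lt be ga -> lt ga al -> hom (u be ga)) ->
  (forall be ga de, lt be ga -> lt ga de -> lt de al ->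
    forall x, u ga de (u be ga x) = u be de x) ->
  exists l, below_cocone al u l /\
    forall be, lt be al -> u be al = (s (l bot) \o l be : E).
Proof.
move=> /bot_min bot_al hu cu; pose I := {be | lt be al}.
pose le (i j : I) := sval i = sval j \/ lt (sval i) (sval j).
have letr i j k : le i j -> le j k -> le i k.
  rewrite /le => -[->|ij] // -[<-|jk]; right=> //.
  exact: lt_trans jk.
have dir : directed_system le (fun i j : I => u (sval i) (sval j)).
  split.
  - by exists (exist _ bot bot_al).
  - by left.
  - exact: letr.
  - move=> i j; have [ij|ij|ji] := lt_total (sval i) (sval j).
    + by exists j; split; [right|left].
    + by exists j; split; left.
    + by exists i; split; [left|right].
  - by move=> i x; rewrite column_id.
  - move=> [i il] [j jl] [k kl] [/= ->|ij] [/= ->|jk] x; rewrite ?column_id //.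
    exact: cu.
have [|l [hl lcoh]] := cocone_to WT dir.
  move=> [i il] [j jl] [/= ->|ij]; last exact: hu.
  by rewrite column_id; exact: hom_id.
apply: (@column_below al (fun be => if pselect (lt be al) is left H
  then l (exist _ be H) else idE)).
split=> [be lt_be|be ga bg ga_al x]; first by case: pselect.
case: pselect => // ga_al'; case: pselect => [be_al|[]]; last exact: lt_trans ga_al.
by apply: (lcoh (exist _ be be_al) (exist _ ga ga_al')); right.
Qed.

Lemma column_system al :
  (forall be, lt be al -> hom (u be al)) /\
  forall be ga, lt be ga -> lt ga al -> forall x, u ga al (u be ga x) = u be al x.
Proof.
move: al; apply: (well_founded_ind lt_wf) => al IH.
have [->|/eqP al_bot] := eqVneq al bot.
  by split=> [be /nlt_bot|be ga _ /nlt_bot].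
have [||l [[hl lcoh] ul]] := column_cocone al_bot.
- by move=> be ga bg /IH[hu _]; exact: hu.
- by move=> be ga de bg gd /IH[_ cu]; exact: cu.
split=> [be lt_be|be ga bg ga_al x].
  rewrite ul //; apply: hom_comp => //; first exact: hl.
  by apply: hom_s; apply: hl; exact: bot_min.
have be_al : lt be al by exact: lt_trans ga_al.
by rewrite !ul //= lcoh.
Qed.

Lemma transfinite_system : exists u : W -> W -> E,
  [/\ forall al, u al al = idE, forall be al, lt be al -> hom (u be al),
    forall be ga al, lt be ga -> lt ga al ->
      forall x, u ga al (u be ga x) = u be al x
    & forall al, al <> bot -> exists l, below_cocone al u l /\
      forall be, lt be al -> u be al = (s (l bot) \o l be : E)].
Proof.
have sys := column_system; exists u; split.
- exact: column_id.
- by move=> be al /((sys al).1 be).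
- by move=> be ga al bg ga_al; exact: (sys al).2.
- move=> al al_bot; apply: column_cocone => //.
    by move=> be ga /((sys ga).1 be).
  by move=> be ga de bg gd _; exact: (sys de).2.
Qed.

End Transfinite.

(** Otherwise each [p] has an endomorphism [s p] that kills a nonzero element of its image.
    Iterating [s] along a well-ordered power set of T makes a new element die at every stage, and T
    has too few elements. *)
Lemma hom_inj_stable (T : Obj) : weakly_terminal T ->
  exists p : {linear car T -> car T}, hom p /\
    forall w : {linear car T -> car T}, hom w ->
      forall x, w (p x) = 0 -> p x = 0.
Proof.
move=> WT; apply: contrapT => np.
have /choice[s sP] : forall p : {linear car T -> car T},
    exists w : {linear car T -> car T}, hom p ->
      hom w /\ exists x, w (p x) = 0 /\ p x <> 0.
  move=> p; have [hp|np'] := pselect (hom p); last by exists p.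
  apply: contrapT => nw; apply: np; exists p; split=> // w hw x wpx.
  by apply: contrapT => px; apply: nw; exists w => _; split=> //; exists x.
have hom_s p : hom p -> hom (s p) by case/sP.
pose W : eqType := {eclassic (car T -> Prop)}.
have [lt [bot [lt_wf lt_trans lt_total bot_min nlt_bot]]] :=
  @pointed_well_order W (fun=> True).
have [u [_ hu cu uP]] :=
  transfinite_system WT lt_wf lt_trans lt_total bot_min nlt_bot hom_s.
(* For [al] other than [bot], [x] is killed at stage [al] and at no earlier stage after [bot], so
   distinct indices get distinct elements. At [bot] the value 0 differs from the others, which are
   nonzero. *)
have /choice[x xP] : forall al : W, exists x : car T,
    (al = bot -> x = 0) /\ (al <> bot -> x <> 0 /\ u bot al x = 0 /\
      forall be, lt bot be -> lt be al -> u bot be x <> 0).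
  move=> al; have [->|/eqP al_bot] := eqVneq al bot; first by exists 0.
  have [l [[hl lcoh] ul]] := uP al al_bot; have bot_al := bot_min _ al_bot.
  have [_ [x [sx lx]]] := sP (l bot) (hl bot bot_al).
  exists x; split=> // _; split.
    by move=> x0; apply: lx; rewrite x0 linear0.
  split=> [|be bot_be be_al ux]; first by rewrite ul.
  by apply: lx; rewrite -(lcoh _ _ bot_be be_al) ux linear0.
apply: (@no_powerset_injection (car T) x) => al be.
wlog al_be : al be / lt al be.
  move=> wl E0; have [lab|->//|lba] := lt_total al be; first exact: wl.
  by apply/esym/wl.
have be_bot : be <> bot by move=> E1; rewrite E1 in al_be; exact: nlt_bot al_be.
move=> E0; exfalso.
have [_ /(_ be_bot)[xbe [_ xbe']]] := xP be.
have [E1|/eqP al_bot] := eqVneq al bot.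
  by apply: xbe; rewrite -E0; have [xal _] := xP al; exact: xal.
have [_ /(_ al_bot)[_ [xal _]]] := xP al.
by apply: (xbe' al (bot_min _ al_bot) al_be); rewrite -E0.
Qed.

(** Take Y over the sequence T -> T -> ... of copies of [p]. Every element of Y comes from some
    [p x]; if [f] kills it, then an endomorphism of T through [f] kills [p x], so [p x] is 0. *)
Lemma weakly_terminal_inj (T : Obj) : weakly_terminal T ->
  exists Y : Obj, weakly_terminal Y /\
    forall f : {linear car Y -> car Y}, hom f -> injective f.
Proof.
move=> WT; have [p [hp pP]] := hom_inj_stable WT.
pose pw n : {linear car T -> car T} :=
  iter n (fun f : {linear car T -> car T} => p \o f) idfun.
have pwS n x : pw n.+1 x = p (pw n x) by [].
have pwD m n x : pw (m + n)%N x = pw m (pw n x).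
  by elim: m => // m IH; rewrite addSn !pwS IH.
have hpw n : hom (pw n).
  by elim: n => [|n IH]; [exact: hom_id|exact: hom_comp].
have dir : directed_system (fun m n : nat => m <= n)%N (fun m n => pw (n - m)%N).
  split.
  - by exists 0%N.
  - by [].
  - by move=> i j k; exact: leq_trans.
  - by move=> i j; exists (maxn i j); rewrite leq_maxl leq_maxr.
  - by move=> i x; rewrite subnn.
  - by move=> i j k ij jk x; rewrite -pwD addnBA // subnK.
have [|Y [l [hl lcoh lsurj]]] := hom_cocone cat dir.
  by move=> i j _; exact: hpw.
exists Y; split=> [X|f hf].
  by have [g hg] := WT X; exists (l 0%N \o g); exact: hom_comp.
have [g hg] := WT Y; apply: linear_ker_inj => y fy.
have [n [x lx]] := lsurj y; have lS : l n.+1 (p x) = l n x.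
  by rewrite -(lcoh n n.+1) // subSn // subnn pwS.
have hw : hom (g \o (f \o l n.+1)).
  by apply: hom_comp => //; exact: hom_comp.
have px : p x = 0 by apply: (pP _ hw); rewrite /= lS lx fy linear0.
by rewrite -lx -lS px linear0.
Qed.

(** Iterate an injective [f] that misses [y], and map the system back to Y by a cocone [l]. Equal
    values [l al y] and [l be y] for al < be would put [y] in the image of [f], so a power set would
    inject into Y. *)
Lemma minimal_object (T : Obj) : weakly_terminal T ->
  exists Y : Obj, weakly_terminal Y /\
    forall f : {linear car Y -> car Y}, hom f -> bijective f.
Proof.
move=> /weakly_terminal_inj[Y [WY injY]]; exists Y; split=> // f hf.
apply: bijective_inj_surj; first exact: injY.
apply: contrapT => nsurj.
have [y ny] : exists y, forall x, f x <> y.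
  by apply: contrapT => H; apply: nsurj => y; apply: contrapT => nx; apply: H;
    exists y => x xy; apply: nx; exists x.
pose W : eqType := {eclassic (car Y -> Prop)}.
have [lt [bot [lt_wf lt_trans lt_total bot_min nlt_bot]]] :=
  @pointed_well_order W (fun=> True).
have [u [uid hu cu uP]] := transfinite_system (s := fun=> f)
  WY lt_wf lt_trans lt_total bot_min nlt_bot (fun _ _ => hf).
have dir : directed_system (fun i j : W => i = j \/ lt i j) u.
  split.
  - by exists bot.
  - by left.
  - by move=> i j k [->|ij] // [<-|jk]; right=> //; exact: lt_trans jk.
  - move=> i j; have [ij|ij|ji] := lt_total i j.
    + by exists j; split; [right|left].
    + by exists j; split; left.
    + by exists i; split; [left|right].
  - by move=> i x; rewrite uid.
  - move=> i j k [->|ij] [->|jk] x; rewrite ?uid //.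
    exact: cu.
have [|l [hl lcoh]] := cocone_to WY dir.
  move=> i j [->|ij]; last exact: hu.
  by rewrite uid; exact: hom_id.
apply: (@no_powerset_injection (car Y) (fun al : W => l al y)) => al be.
wlog al_be : al be / lt al be.
  move=> wl E0; have [lab|->//|lba] := lt_total al be; first exact: wl.
  by apply/esym/wl.
have be_bot : be <> bot by move=> E1; rewrite E1 in al_be; exact: nlt_bot al_be.
have [l' [_ ul]] := uP be be_bot; move=> E0; exfalso.
have := injY _ (hl be) _ _ (etrans (lcoh al be (or_intror al_be) y) E0).
by rewrite ul //= => /ny.
Qed.

End Minimality.

(** * Covers *)

Section Over.
Variables (R : pzRingType) (M : lmodType R -> Prop) (N : lmodType R).

Record over := Over {
  over_mod : lmodType R;
  over_map : {linear over_mod -> N};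
  over_in : M over_mod
}.

Definition over_hom (X Y : over) (f : {linear over_mod X -> over_mod Y}) : Prop :=
  forall x, over_map Y (f x) = over_map X x.

Lemma over_category (C : lmodType R^c -> Prop) :
  duality_pair M C -> closed_under_coproducts M -> concrete_category over_hom.
Proof.
move=> MC coprodM; split=> [X x|X Y Z f g hf hg x|X I le u dir hu] //.
  by rewrite -hf -hg.
have [Z [l [cl /(_ M C MC coprodM (over_in X)) MZ]]] := colim_exists dir.
have [|h hP] := colim_factor (f := fun=> over_map X) dir cl.
  by move=> i j /hu hij x; exact: hij.
exists (Over h MZ), l; split.
- by move=> i x; exact: hP.
- exact: colim_coh cl.
- exact: colim_surj cl.
Qed.

End Over.

(** Precovers are the weakly terminal objects among the modules of M over N, and covers those with
    bijective endomorphisms only. *)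
Lemma duality_pair_covering (R : pzRingType) (M : lmodType R -> Prop)
    (C : lmodType R^c -> Prop) :
  duality_pair M C -> closed_under_coproducts M -> covering M.
Proof.
move=> MC coprodM N; have cat := @over_category R M N C MC coprodM.
have [A [phi [MA phiP]]] := duality_pair_precover MC coprodM N.
have WT : weakly_terminal (@over_hom R M N) (Over phi MA).
  move=> [B psi MB]; have [f fP] := phiP B MB psi.
  by exists f => x; rewrite /= fP.
have [[B psi MB] [WB bijB]] := minimal_object cat WT.
exists B, psi; split=> [|f psif]; last by apply: bijB => x; exact/esym/psif.
split=> // B' MB' psi'; have [f fP] := WB (Over psi' MB').
by exists f => x; exact/esym/(fP x).
Qed.

(** * Extensions *)

Section Extensions.
Variable R : pzRingType.
Implicit Types A B K P X Y : lmodType R.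

Lemma bijective_linear_inverse A B (f : {linear A -> B}) : bijective f ->
  exists g : {linear B -> A}, (forall x, g (f x) = x) /\ forall y, f (g y) = y.
Proof.
case=> g fK gK; have gL : linear g.
  by move=> a x y; apply: (can_inj fK); rewrite linearP !gK.
by exists (mkLin gL).
Qed.

(* Taking pushouts, this says that every extension of B by Y splits.          *)
Definition ext_lift B Y : Prop :=
  forall K P (i : {linear K -> P}) (p : {linear P -> B}), short_exact i p ->
  forall g : {linear K -> Y}, exists h : {linear P -> Y}, forall k, h (i k) = g k.

Definition cover_of A : {linear freemod R A -> A} :=
  projT1 (cid (freemod_univ (id : A -> A))).

Lemma cover_of_surj A : surjective (cover_of A).
Proof.
by move=> a; exists (freemod_gen R a); rewrite /cover_of; case: cid => h /= ->.
Qed.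

Lemma free_resolution X : exists (P : nat -> lmodType R)
  (d : forall n, {linear P n.+1 -> P n}) (e : {linear P 0%N -> X}),
  projective_resolution d e.
Proof.
pose K n : lmodType R := iter n (fun A => subm (ker_submod (cover_of A))) X.
pose P n := freemod R (K n); pose e n : {linear P n -> K n} := cover_of (K n).
pose i n : {linear K n.+1 -> P n} := subm_incl (ker_submod (e n)).
have ex n : exact (i n \o e n.+1) (e n).
  move=> y; split=> [ey|[x <-]].
    have [k ky] := subm_incl_surj (W := ker_submod (e n)) ey.
    have [x xk] := @cover_of_surj (K n.+1) k.
    by exists x; rewrite /= -ky; congr (i n _).
  exact: (subm_inclP (e n.+1 x : subm (ker_submod (e n)))).
exists P, (fun n => i n \o e n.+1), (e 0%N); split.
- by move=> n; exact: freemod_projective.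
- exact: cover_of_surj.
- exact: ex.
- move=> n y; apply: iff_trans (ex n.+1 y); split=> E; last first.
    by change (i n (e n.+1 y) = 0); rewrite E linear0.
  by apply: (@subm_incl_inj _ _ (ker_submod (e n))); rewrite linear0.
Qed.

(** From left to right, a free resolution of B is compared with the extension, and [g] becomes a
    cocycle. From right to left, the lifting property is applied to the kernel of the augmentation
    [e]. *)
Lemma Ext1_eq0P B Y : Ext1_eq0 B Y <-> ext_lift B Y.
Proof.
split=> [extBY K P i p [inj_i ex_ip sp] g|lift Q d e [_ se ex0 ex1] phi phid].
  have [Q [d [e res]]] := free_resolution B; have [Qproj se ex0 ex1] := res.
  have [la laP] := Qproj 0%N _ _ p e sp.
  have [|ka kaP] := factor_inj (f := la \o d 0%N) inj_i.
    move=> x; apply/ex_ip; rewrite /= laP; apply/ex0.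
    by exists x.
  have kd x : ka (d 1%N x) = 0.
    apply: inj_i; rewrite kaP linear0 /=.
    have -> : d 0%N (d 1%N x) = 0 by apply/(ex1 0%N); exists x.
    exact: linear0.
  have [|psi psiP] := extBY Q d e res (g \o ka).
    by move=> x; rewrite /= kd linear0.
  (* P is the sum of the images of [la] and [i]. They overlap in the boundaries, where [psi] and [g]
     agree since [psi] cobounds [g \o ka]. *)
  have [|a _ _ _ _ [q [k [-> ->]]] [q' [k' [-> ->]]]|y [q [k [E ->]]]|h hP] :=
    @linear_of_rel R P Y (fun x y => exists q k, x = la q + i k /\ y = psi q + g k).
  - move=> x; have [q eq] := se (p x).
    have [k ki] : exists k, i k = x - la q.
      by apply/ex_ip; rewrite linearB laP eq subrr.
    by exists (psi q + g k), q, k; rewrite ki addrC subrK.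
  - exists (a *: q + q'), (a *: k + k').
    by rewrite !linearP !scalerDr; split; rewrite addrACA.
  - have [z zq] : exists z, d 0%N z = q.
      apply/ex0; rewrite -laP; have -> : la q = - i k.
        by apply/eqP; rewrite -addr_eq0 -E.
      rewrite linearN; have -> : p (i k) = 0 by apply/ex_ip; exists k.
      by rewrite oppr0.
    have -> : k = - ka z.
      apply: inj_i; rewrite linearN kaP /= zq; apply/eqP.
      by rewrite -addr_eq0 addrC -E.
    by rewrite linearN -zq -psiP subrr.
  by exists h => k; apply: hP; exists 0, k; rewrite !linear0 !add0r.
pose W := ker_submod e.
have [|d' d'P] := factor_inj (f := d 0%N) (@subm_incl_inj _ _ W).
  move=> x; apply: subm_incl_surj.
  by apply/ex0; exists x.
have sd' : surjective d'.
  move=> w; have /ex0[x xw] := subm_inclP w; exists x.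
  by apply: (@subm_incl_inj _ _ W); rewrite d'P.
have [|g gP] := factor_surj (f := phi) sd'.
  move=> x d'x; have /ex1[z <-] : d 0%N x = 0 by rewrite -d'P d'x linear0.
  exact: phid.
have [|h hP] := lift _ _ (subm_incl W) e _ g.
  split; [exact: subm_incl_inj| |exact: se].
  move=> y; split=> [ey|[w <-]]; last exact: (subm_inclP w).
  exact: (@subm_incl_surj _ _ W).
by exists h => x; rewrite -d'P hP gP.
Qed.

Lemma pushout K P B Y (i : {linear K -> P}) (p : {linear P -> B})
    (g : {linear K -> Y}) : short_exact i p ->
  exists (Q : lmodType R) (qY : {linear Y -> Q}) (qP : {linear P -> Q})
    (pB : {linear Q -> B}),
  [/\ short_exact qY pB, forall k, qY (g k) = qP (i k)
    & forall (Z : lmodType R) (a : {linear Y -> Z}) (b : {linear P -> Z}),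
        (forall k, a (g k) = b (i k)) ->
        exists h : {linear Q -> Z}, (forall y, h (qY y) = a y) /\
          forall x, h (qP x) = b x].
Proof.
move=> [inj_i ex_ip sp].
pose w (z : (Y * P)%type) : Prop := exists k, z = (g k, - i k).
have w0 : w 0 by exists 0; rewrite !linear0 ?oppr0.
have wP r x y : w x -> w y -> w (r *: x + y).
  move=> [k ->] [k' ->]; exists (r *: k + k'); rewrite !linearP.
  by congr (_, _); rewrite /= opprD scalerN.
pose W := Submod w0 wP; pose pi := quotm_proj W.
pose qY : {linear Y -> quotm W} := pi \o @pair_in R Y P true.
pose qP : {linear P -> quotm W} := pi \o @pair_in R Y P false.
have pairE (y : Y) (x : P) : ((y, x) : (Y * P)%type) = (y, 0) + (0, x).
  by congr (_, _); rewrite /= ?addr0 ?add0r.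
have piE y x : pi (y, x) = qY y + qP x by rewrite pairE linearD.
have univ (Z : lmodType R) (a : {linear Y -> Z}) (b : {linear P -> Z}) :
    (forall k, a (g k) = b (i k)) ->
    exists h : {linear quotm W -> Z}, (forall y, h (qY y) = a y) /\
      forall x, h (qP x) = b x.
  move=> ab; have cL : linear (fun z : (Y * P)%type => a z.1 + b z.2).
    by move=> r x y; rewrite /= !linearP scalerDr addrACA.
  have [|h hP] := factor_surj (f := mkLin cL) (@quotm_proj_surj _ _ W).
    move=> z /quotm_proj_eq0[k ->] /=.
    by rewrite linearN ab subrr.
  exists h; split=> [y|x]; rewrite hP /=.
    by rewrite linear0 addr0.
  by rewrite linear0 add0r.
have glue k : qY (g k) = qP (i k).
  apply/eqP; rewrite -subr_eq0 -linearN -piE; apply/eqP/quotm_proj_eq0.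
  by exists k.
pose zero : {linear Y -> B} := \0.
have [|pB [pBY pBP]] := univ B zero p.
  by move=> k; apply/esym/ex_ip; exists k.
exists (quotm W), qY, qP, pB; split=> //; split.
- apply: linear_ker_inj => y /quotm_proj_eq0[k [-> /esym ik]].
  suff -> : k = 0 by exact: linear0.
  by apply: inj_i; rewrite linear0 -[LHS]opprK ik oppr0.
- move=> q; split=> [|[y <-]]; last by rewrite pBY.
  have [[y x] <-] := quotm_proj_surj q; rewrite -/pi piE linearD pBY pBP add0r.
  by move=> /ex_ip[k <-]; exists (y + g k); rewrite linearD glue.
- by move=> b; have [x <-] := sp b; exists (qP x); rewrite pBP.
Qed.

End Extensions.

(** * Envelopes and cotorsion pairs *)

Section Under.
Variables (R : pzRingType) (M : lmodType R -> Prop) (N : lmodType R).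

Record under := Under {
  under_mod : lmodType R;
  under_coker : lmodType R;
  under_map : {linear N -> under_mod};
  under_proj : {linear under_mod -> under_coker};
  under_exact : short_exact under_map under_proj;
  under_in : M under_coker
}.

Definition under_hom (X Y : under) (f : {linear under_mod X -> under_mod Y}) :=
  forall n, f (under_map X n) = under_map Y n.

(** Endomorphisms under N induce endomorphisms of the cokernel. The colimit of the middle terms is
    again an extension by N, with cokernel the colimit of the cokernels, which is in M. *)
Lemma under_category (C : lmodType R^c -> Prop) :
  duality_pair M C -> closed_under_coproducts M -> concrete_category under_hom.
Proof.
move=> MC coprodM; split=> [X n|X Y Z f g hf hg n|X I le u dir hu] //.
  by rewrite /= hf hg.
case: X u dir hu => E B i p ex MB /= u dir hu; have [inj_i ex_ip sp] := ex.
have [[i0 _] lerefl letrans ub uid ucomp] := dir.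
have ui j k n : le j k -> u j k (i n) = i n by move=> /hu; apply.
have ub_ex (jk : I * I) : exists v : {linear B -> B}, le jk.1 jk.2 ->
    forall x, v (p x) = p (u jk.1 jk.2 x).
  have [jk_le|njk] := pselect (le jk.1 jk.2); last by exists idfun.
  have [|v vP] := factor_surj (f := p \o u jk.1 jk.2) sp.
    by move=> x /ex_ip[n <-] /=; rewrite ui //; apply/ex_ip; exists n.
  by exists v.
have [v' v'P] := choice ub_ex; pose v j k := v' (j, k).
have vP j k : le j k -> forall x, v j k (p x) = p (u j k x).
  exact: (v'P (j, k)).
have dirB : directed_system le v.
  split.
  - by exists i0.
  - exact: lerefl.
  - exact: letrans.
  - exact: ub.
  - by move=> j b; have [x <-] := sp b; rewrite vP ?uid.
  - move=> j k l jk kl b; have [x <-] := sp b.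
    by rewrite !vP ?ucomp //; exact: letrans kl.
have [Z [l [cl _]]] := colim_exists dir.
have [ZB [lB [clB /(_ M C MC coprodM MB) MZB]]] := colim_exists dirB.
have [|pZ pZP] := colim_factor (f := fun j => lB j \o p) dir cl.
  by move=> j k jk x; rewrite /= -vP // (colim_coh clB).
have li j n : l j (i n) = l i0 (i n).
  have [k [jk ik]] := ub j i0.
  by rewrite -(colim_coh cl jk) ui // -(colim_coh cl ik) ui.
have exZ : short_exact (l i0 \o i) pZ.
  split.
  - apply: linear_ker_inj => n /(colim_sep cl)[j [ij]]; rewrite ui // => in0.
    by apply: inj_i; rewrite in0 linear0.
  - move=> z; split=> [|[n <-]]; last first.
      rewrite /= pZP /=; have -> : p (i n) = 0 by apply/ex_ip; exists n.
      exact: linear0.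
    have [j [x <-]] := colim_surj cl z; rewrite pZP.
    move=> /(colim_sep clB)[k [jk]]; rewrite vP // => /ex_ip[n nE].
    by exists n; rewrite /= -(li k) nE (colim_coh cl).
  - move=> b; have [j [y <-]] := colim_surj clB b; have [x <-] := sp y.
    by exists (l j x); rewrite pZP.
exists (Under exZ MZB), l; split.
- by move=> j n; exact: li.
- exact: colim_coh cl.
- exact: colim_surj cl.
Qed.

(* The pullback of E -> E/N, with E injective over N, along a precover of E/N  *)
Lemma under_weakly_terminal :
  (forall Q : lmodType R, exists (A : lmodType R) (phi : {linear A -> Q}),
    is_precover M phi) ->
  exists T, weakly_terminal under_hom T.
Proof.
move=> precov; have [E [j [inj_j injE]]] := inj_embedding N.
pose w (e : E) := exists n, j n = e.
have w0 : w 0 by exists 0; rewrite linear0.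
have wP a x y : w x -> w y -> w (a *: x + y).
  by move=> [m <-] [n <-]; exists (a *: m + n); rewrite linearP.
pose W := Submod w0 wP.
have [A [phi [MA phiP]]] := precov (quotm W).
pose d : {linear (A * E)%type -> quotm W} :=
  (phi \o fst) \- (quotm_proj W \o snd).
pose K := ker_submod d.
have KP z : K z <-> phi z.1 = quotm_proj W z.2.
  split=> [/subr0_eq //|E0].
  by change (phi z.1 - quotm_proj W z.2 = 0); rewrite E0 subrr.
have [|i iP] := factor_inj (f := @pair_in R A E false \o j) (@subm_incl_inj _ _ K).
  move=> n; apply: subm_incl_surj; apply/KP; rewrite /= linear0.
  by apply/esym/quotm_proj_eq0; exists n.
have pL : linear (fun y : subm K => (subm_incl K y).1) by move=> a x y.
pose p : {linear subm K -> A} := mkLin pL.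
have ex : short_exact i p.
  split.
  - apply: linear_ker_inj => n i0; apply: inj_j; rewrite linear0.
    by have := congr1 snd (iP n); rewrite i0 linear0 /= => <-.
  - move=> y; split=> [py|[n <-]]; last first.
      by change ((subm_incl K (i n)).1 = 0); rewrite iP.
    have := (KP _).1 (subm_inclP y); rewrite -[X in phi X]/(p y) py linear0.
    move=> /esym/quotm_proj_eq0[n nE]; exists n; apply: (@subm_incl_inj _ _ K).
    by rewrite iP [RHS]surjective_pairing; congr (_, _).
  - move=> a; have [e eP] := quotm_proj_surj (phi a).
    have [y yE] := @subm_incl_surj _ _ K (a, e) ((KP (a, e)).2 (esym eP)).
    by exists y; change ((subm_incl K y).1 = a); rewrite yE.
exists (Under ex MA) => -[F B i' p' ex' MB] /=.
have [inj_i' ex_ip' sp'] := ex'; have [e1 e1P] := injE _ _ i' j inj_i'.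
have [|b0 b0P] := factor_surj (f := quotm_proj W \o e1) sp'.
  move=> x /ex_ip'[n <-] /=; rewrite e1P.
  by apply/quotm_proj_eq0; exists n.
have [psi psiP] := phiP _ MB b0.
have mL : linear (fun x => (psi (p' x), e1 x) : (A * E)%type).
  by move=> a x y; rewrite !linearP.
have [|f fP] := factor_inj (f := mkLin mL) (@subm_incl_inj _ _ K).
  by move=> x; apply: subm_incl_surj; apply/KP; rewrite /= -psiP b0P.
exists f => n; apply: (@subm_incl_inj _ _ K); rewrite fP iP /= e1P.
have -> : p' (i' n) = 0 by apply/ex_ip'; exists n.
by rewrite linear0.
Qed.

(** Let Q be the pushout of an extension of B along [g]. Then Q/N is an extension of B by the
    cokernel of N, so it is in M and Q maps back to the middle term E under N. The composite E -> Q
    -> E is bijective by minimality, so E -> Q splits and [g] extends. *)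
Lemma minimal_under_right_perp (Y : under) :
  closed_under_extensions M -> weakly_terminal under_hom Y ->
  (forall f : {linear under_mod Y -> under_mod Y}, under_hom f -> bijective f) ->
  right_perp M (under_mod Y).
Proof.
move=> extM WT bij B MB; apply/Ext1_eq0P => K P k p exP g.
have [Q [qY [qP [pB [exQ glue _]]]]] := pushout g exP.
case: Y WT bij g qY exQ glue => E A i pA exE MA /= WT bij g qY exQ glue.
have [inj_i ex_i spA] := exE; have [inj_q ex_q spB] := exQ.
pose w (e : Q) := exists n, qY (i n) = e.
have w0 : w 0 by exists 0; rewrite !linear0.
have wP a x y : w x -> w y -> w (a *: x + y).
  by move=> [m <-] [n <-]; exists (a *: m + n); rewrite !linearP.
pose W := Submod w0 wP.
have exN : short_exact (qY \o i) (quotm_proj W).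
  split; [exact: inj_comp| |exact: quotm_proj_surj] => x.
  exact: quotm_proj_eq0.
have [|a aP] := factor_surj (f := quotm_proj W \o qY) spA.
  by move=> x /ex_i[n <-]; apply/quotm_proj_eq0; exists n.
have [|b bP] := factor_surj (f := pB) (@quotm_proj_surj _ _ W).
  by move=> x /quotm_proj_eq0[n <-]; apply/ex_q; exists (i n).
have exAB : short_exact a b.
  split.
  - apply: linear_ker_inj => x; have [y <-] := spA x; rewrite aP.
    move=> /quotm_proj_eq0[n /inj_q <-].
    by apply/ex_i; exists n.
  - move=> x; have [z <-] := quotm_proj_surj x; rewrite bP ex_q.
    split=> [[y <-]|[c]]; first by exists (pA y); rewrite aP.
    have [y <-] := spA c; rewrite aP => /quotm_piE[n nE].
    by exists (y - i n); rewrite linearB nE opprB addrC subrK.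
  - by move=> x; have [y <-] := spB x; exists (quotm_proj W y); rewrite bP.
have MW : M (quotm W) by exact: extM exAB MA MB.
have [r rP] := WT (Under exN MW).
have bij_r : bijective (r \o qY) by apply: bij => n; exact: rP.
have [t [trK rtK]] := bijective_linear_inverse bij_r.
by exists (t \o (r \o qP)) => x; rewrite /= -glue; exact: trK.
Qed.

End Under.

Lemma perfect_pair_enveloping (R : pzRingType) (M : lmodType R -> Prop)
    (C : lmodType R^c -> Prop) :
  duality_pair M C -> closed_under_coproducts M -> closed_under_extensions M ->
  enveloping (right_perp M).
Proof.
move=> MC coprodM extM N; have cat := @under_category R M N C MC coprodM.
have [T WT] := @under_weakly_terminal R M N (duality_pair_precover MC coprodM).
have [Y [WY bijY]] := minimal_object cat WT.
exists (under_mod Y), (under_map Y); split=> [|f fP]; last first.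
  by apply: bijY => n; exact/esym/fP.
split=> [|A perpA g]; first exact: minimal_under_right_perp WY bijY.
have /Ext1_eq0P lift := perpA _ (under_in Y).
have [h hP] := lift _ _ _ _ (under_exact Y) g.
by exists h => n.
Qed.

(* Wakamatsu's lemma *)
Lemma cover_kernel_right_perp (R : pzRingType) (M : lmodType R -> Prop)
    (A X : lmodType R) (phi : {linear A -> X}) :
  closed_under_extensions M -> is_cover M phi ->
  right_perp M (subm (ker_submod phi)).
Proof.
move=> extM [[MA phiP] bij] B MB; apply/Ext1_eq0P => K P i p ex g.
pose k := subm_incl (ker_submod phi).
have phik y : phi (k y) = 0 by exact: (subm_inclP y).
have [Q [qA [qP [pB [exQ glue univ]]]]] := pushout (k \o g) ex.
have MQ : M Q by exact: extM exQ MA MB.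
pose zero : {linear P -> X} := \0.
(* Since [phi] kills its kernel, it extends to the pushout by zero on P. A lift of this extension
   through the cover restricts to an automorphism of A. *)
have [|c [cA cP]] := univ X phi zero; first by move=> x; exact: phik.
have [psi psiP] := phiP Q MQ c.
have bij_psi : bijective (psi \o qA) by apply: bij => x; rewrite /= -psiP cA.
have [t [tK Kt]] := bijective_linear_inverse bij_psi.
have phit y : phi (t y) = phi y by rewrite -[in RHS](Kt y) /= -psiP cA.
have [|h hP] :=
  factor_inj (f := t \o (psi \o qP)) (@subm_incl_inj _ _ (ker_submod phi)).
  move=> x; apply: subm_incl_surj.
  by change (phi (t (psi (qP x))) = 0); rewrite phit -psiP cP.
exists h => x; apply: (@subm_incl_inj _ _ (ker_submod phi)); rewrite hP /= -glue.
exact: tK.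
Qed.

Lemma precover_surj (R : pzRingType) (M : lmodType R -> Prop)
    (A X : lmodType R) (phi : {linear A -> X}) :
  closed_under_coproducts M -> M R^o -> is_precover M phi -> surjective phi.
Proof.
move=> coprodM MR [_ phiP] x.
have MF : M (freemod R X).
  exact: coprodM (@dsum_is_coproduct R X (fun=> R^o)) (fun=> MR).
have [f fP] := phiP _ MF (cover_of X).
by have [y <-] := @cover_of_surj R X x; exists (f y); rewrite fP.
Qed.

Lemma perfect_pair_cotorsion (R : pzRingType) (M : lmodType R -> Prop)
    (C : lmodType R^c -> Prop) :
  duality_pair M C -> closed_under_coproducts M -> closed_under_extensions M ->
  M R^o -> cotorsion_pair M (right_perp M).
Proof.
move=> MC coprodM extM MR; split=> // X; split=> [MX Y perpY|perpX].
  exact: perpY.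
have [A [phi cov]] := duality_pair_covering MC coprodM X.
have [pre _] := cov; have [MA _] := pre.
have sphi := precover_surj coprodM MR pre.
pose K := ker_submod phi.
have exK : short_exact (subm_incl K) phi.
  split; [exact: subm_incl_inj| |exact: sphi] => y.
  by split=> [|[x <-]]; [exact: (@subm_incl_surj _ _ K)|exact: (subm_inclP x)].
have /Ext1_eq0P lift := perpX _ (cover_kernel_right_perp extM cov).
have [rho rhoP] := lift _ _ _ _ exK idfun.
(* The identity minus the retraction onto the kernel descends to X as a linear section of [phi],
   which makes [phi] a pure quotient map. *)
have [|h hP] := factor_surj (f := mkLin (linearP
    (idfun \- (subm_incl K \o rho) : {linear A -> A}))) sphi.
  move=> x px; have [y <-] := @subm_incl_surj _ _ K x px.
  by rewrite /= rhoP subrr.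
have phih y : phi (h y) = y.
  have [x <-] := sphi y; rewrite hP /= linearB.
  by rewrite [X in _ - X](subm_inclP (rho x)) subr0.
have pphi : pure_epi phi.
  by move=> L; exists h; split=> // *; rewrite linearP.
by have [/(_ MA)[]] := pure_epi_closed MC exK pphi.
Qed.

Theorem mainTheorem3 (R : pzRingType) (M : lmodType R -> Prop)
    (C : lmodType R^c -> Prop) (MC : duality_pair M C) :
  pure_closed M /\
  (product_closed M C -> preenveloping M) /\
  (coproduct_closed M C -> covering M) /\
  (perfect_duality_pair M C -> perfect_cotorsion_pair M (right_perp M)).
Proof.
split; first exact: duality_pair_pure_closed MC.
split=> [[_ prodM]|]; first exact: duality_pair_preenveloping MC prodM.
split=> [[_ coprodM]|[[_ coprodM] extM MR]].
  exact: duality_pair_covering MC coprodM.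
split.
- exact: perfect_pair_cotorsion MC coprodM extM MR.
- exact: duality_pair_covering MC coprodM.
- exact: perfect_pair_enveloping MC coprodM extM.
Qed.
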